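(* Let $\mathcal{B}=(B_n)_{n\in\mathbb{N}}$ be a sequence of closed balls of $\mathbb{R}^d$ such that $|B_n|\to 0$, and let $\mathcal{U}=(U_n)_{n\in\mathbb{N}}$ be a sequence of open sets such that $U_n\subset B_n$ for all $n\in\mathbb{N}$. Then, for every Borel probability measure $\mu$ on $\mathbb{R}^d$ such that $\min\{s(\mu,\mathcal{B},\mathcal{U}),\underline{\dim}_H(\mu)\}>0$, there exists a gauge function $\zeta:\mathbb{R}^+\to\mathbb{R}^+$ such that $$\lim_{r\to 0^+}\frac{\log\zeta(r)}{\log r}=\min\{s(\mu,\mathcal{B},\mathcal{U}),\underline{\dim}_H(\mu)\}\quad\text{and}\quad \mathcal{H}^{\zeta}\Big(\limsup_{n\to+\infty}U_n\Big)>0 .$$ In particular, for every Borel probability measure $\mu$ on $\mathbb{R}^d$, $$\dim_H\Big(\limsup_{n\to+\infty}U_n\Big)\ \geq\ \min\{s(\mu,\mathcal{B},\mathcal{U}),\underline{\dim}_H(\mu)\}.$$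
   Context: $\mathbb{R}^d$ is endowed with $\|\cdot\|_\infty$; $B(x,r)$ is the closed ball, $|B|$ the diameter of $B$; $\dim_H$ is Hausdorff dimension; $\limsup_n U_n=\bigcap_{N}\bigcup_{n\ge N}U_n$. Gauge functions and Hausdorff measures: a gauge function is $\zeta:\mathbb{R}^+\to\mathbb{R}^+$, increasing in a neighborhood of $0$, with $\zeta(0)=0$. For $t\in(0,+\infty]$, $\mathcal{H}^\zeta_t(E)=\inf\{\sum_n\zeta(|L_n|): |L_n|\le t,\ L_n\text{ closed balls},\ E\subset\bigcup_n L_n\}$ and $\mathcal{H}^\zeta(E)=\lim_{t\to0^+}\mathcal{H}^\zeta_t(E)$. For $\zeta(x)=x^s$ one writes $\mathcal{H}^s_t$; $\mathcal{H}^s_\infty$ is the $s$-dimensional Hausdorff content. $\underline{\dim}_H(\mu)=\mathrm{ess\,inf}_\mu\,\underline{\dim}_{\rm loc}(\mu,x)$, where $\underline{\dim}_{\rm loc}(\mu,x)=\liminf_{r\to0^+}\frac{\log\mu(B(x,r))}{\log r}$ for $x\in\mathrm{supp}(\mu)$. $\mu$-asymptotically covering ($\mu$-a.c.): a countable family of balls $(B_n)_{n\in\mathcal N}$, $\mathcal N\subset\mathbb{N}$, is $\mu$-a.c. if there is a constant $C>0$ such that for every open set $\Omega\subset\mathbb{R}^d$ and every $g\in\mathbb{N}$ there is a (possibly empty) finite family of pairwise disjoint balls $B_{n_1},\dots,B_{n_{N_\Omega}}$ with $n_i\in\mathcal N$, $n_i\ge g$, $B_{n_i}\subset\Omega$,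 and $\mu(\bigcup_{i}B_{n_i})\ge C\mu(\Omega)$. $\mu$-essential Hausdorff content: for a Borel set $A$ and $s\ge0$, $\mathcal{H}^{\mu,s}_\infty(A)=\inf\{\mathcal{H}^s_\infty(E): E\subset A\text{ Borel},\ \mu(E)=\mu(A)\}$. $\mu$-critical exponents: $s_\mu(B,U)=\sup\{s\ge0:\mathcal{H}^{\mu,s}_\infty(U)\ge\mu(B)\}$; $\mathcal{N}_\mu(\mathcal{B},\mathcal{U},s)=\{n\in\mathbb{N}: s_\mu(B_n,U_n)\ge s\}$; and $s(\mu,\mathcal{B},\mathcal{U})=\sup\{s\ge0: (B_n)_{n\in\mathcal{N}_\mu(\mathcal{B},\mathcal{U},s)}\text{ is }\mu\text{-a.c.}\}$, with $\sup\emptyset=-\infty$. *)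

(* Defs.v *)
From HB Require Import structures.
From mathcomp Require Import all_boot all_order all_algebra.
From mathcomp Require Import all_classical all_reals all_analysis ess_sup_inf.

Set Implicit Arguments.
Unset Strict Implicit.
Unset Printing Implicit Defensive.

Import Order.TTheory GRing.Theory Num.Theory.
Import numFieldNormedType.Exports.

Local Open Scope classical_set_scope.
Local Open Scope ring_scope.

(* The norm of the library on ['rV[R]_d] is the sup norm.  [borelRV R d] is
   R^d equipped with the sigma-algebra generated by its open sets. *)
Notation borelRV R d := (g_sigma_algebraType (@open 'rV[R]_d)).

Section hausdorff.
Context {R : realType} {d : nat}.
Implicit Types (A E L U : set 'rV[R]_d) (zeta : R -> R).

(* The real-valued [sup] is only meaningful for bounded nonempty sets; [diam] is
   only used on closed balls. *)
Definition diam A : R := sup [set `|x - y| | x in A & y in A].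

Definition is_closed_ball L : Prop :=
  exists (x : 'rV[R]_d) (r : R), 0 < r /\ L = closed_ball x r.

(* A map from R^+ to R^+ is encoded as a map on R that is nonnegative on R^+;
   its values at negative arguments are never used. *)
Definition gauge_function zeta : Prop :=
  [/\ forall x, 0 <= x -> 0 <= zeta x,
      exists2 e : R, 0 < e &
        (forall x y, 0 <= x -> x < y -> y < e -> zeta x < zeta y)
    & zeta 0 = 0].

(* The index set [D] allows for finite as well as countably infinite covers. *)
Definition ball_cover (t : \bar R) E (D : set nat) (L : nat -> set 'rV[R]_d) :
    Prop :=
  (forall n, D n -> is_closed_ball (L n) /\ ((diam (L n))%:E <= t)%E) /\
  E `<=` \bigcup_(n in D) L n.

Definition hausdorff_content zeta (t : \bar R) E : \bar R :=
  ereal_inf [set (\esum_(n in DL.1) (zeta (diam (DL.2 n)))%:E)%E |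
             DL in [set DL | ball_cover t E DL.1 DL.2]].

Definition hausdorff_measure zeta E : \bar R :=
  lim (hausdorff_content zeta t%:E E @[t --> 0^'+]).

Definition hausdorff_dim E : \bar R :=
  ereal_inf [set s%:E | s in
    [set s : R | 0 <= s /\ hausdorff_measure (fun x => x `^ s) E = 0%E]].

End hausdorff.

Section mu_dependent.
Context {R : realType} {d : nat} (mu : probability (borelRV R d) R).
Implicit Types (A E U : set 'rV[R]_d) (B : nat -> set 'rV[R]_d).

(* As [lne 0 = -oo], the quotient is [+oo] when [mu (closed_ball x r) = 0] and
   [r < 1]; hence this dimension is [+oo] off the support of [mu]. *)
Definition lower_local_dim (x : 'rV[R]_d) : \bar R :=
  limf_einf (fun r : R => lne (mu (closed_ball x r)) * ((ln r)^-1)%:E)%E 0^'+.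

Definition lower_hausdorff_dim : \bar R := ess_inf mu lower_local_dim.

Definition asymptotically_covering B (N : set nat) : Prop :=
  exists2 C : R, 0 < C &
    forall (Omega : set 'rV[R]_d) (g : nat), open Omega ->
      exists F : set nat,
        [/\ finite_set F,
            F `<=` N,
            forall n, F n -> (g <= n)%N /\ B n `<=` Omega,
            trivIset F B
          & (C%:E * mu Omega <= mu (\bigcup_(n in F) B n))%E].

Definition ess_hausdorff_content (s : R) A : \bar R :=
  ereal_inf [set hausdorff_content (fun x => x `^ s) +oo%E E | E in
    [set E : set 'rV[R]_d |
      [/\ measurable (E : set (borelRV R d)), E `<=` A & mu E = mu A]]].

Definition critical_exponent_ball (B U : set 'rV[R]_d) : \bar R :=
  ereal_sup [set s%:E | s in
    [set s : R | 0 <= s /\ (mu B <= ess_hausdorff_content s U)%E]].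

Definition critical_indices B (U : nat -> set 'rV[R]_d) (s : R) : set nat :=
  [set n | (s%:E <= critical_exponent_ball (B n) (U n))%E].

(* [ereal_sup set0 = -oo], here and in [critical_exponent_ball]. *)
Definition critical_exponent B (U : nat -> set 'rV[R]_d) : \bar R :=
  ereal_sup [set s%:E | s in
    [set s : R | 0 <= s /\ asymptotically_covering B (critical_indices B U s)]].

End mu_dependent.

(* Main.v *)
(**
Let s be the minimum of the two exponents and let t_0 < t_1 < ... increase to s. By the covering
property one builds finite levels of indices such that the balls of level j + 1 inside U_n, n of
level j, are disjoint, cover most of U_n for mu, are tiny, and satisfy
mu(B_m) <= H^{mu,s'}(U_m) for some s' > t_{j+1}. The gauge is x^{t_j} at the scales between those
of levels j and j + 1.

Suppose that balls L_i with small total gauge cover the limsup set. Call an index m of level j good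
if every L_i meeting U_m is smaller than B_m and the total gauge of these L_i is at most a large
constant times mu(B_m). The constant is harmless since passing from the exponent t_{j+1} to t_j
gains a power of the radius of B_m. By definition of the essential content and a compactness
argument, the L_i (even enlarged) then miss a part of U_m whose measure is bounded below
independently of the cover; the L_i at the scales of later levels are handled by the lower
Hausdorff dimension of mu. So the balls of the next level that are not engulfed by an enlarged L_i
have substantial total measure, and as each L_i meets boundedly many larger disjoint balls, one of
them is good. Iterating gives a point common to a decreasing sequence of good balls. It lies in the
limsup set, hence in some L_i, which would be smaller than all of these balls.
*)

Require Import Defs.
From HB Require Import structures.
From mathcomp Require Import all_boot all_order all_algebra.
From mathcomp Require Import finmap.
From mathcomp Require Import all_classical all_reals all_analysis ess_sup_inf.
From mathcomp Require Import ring lra zify.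

Set Implicit Arguments.
Unset Strict Implicit.
Unset Printing Implicit Defensive.

Import Order.TTheory GRing.Theory Num.Theory.
Import numFieldNormedType.Exports.

Local Open Scope classical_set_scope.
Local Open Scope ring_scope.

(** * Inequalities for sums over arbitrary index sets *)

Section esum_extra.
Context {R : realType}.
Local Open Scope ereal_scope.

Lemma esum_subset (T : choiceType) (A B : set T) (a : T -> \bar R) :
  A `<=` B -> \esum_(i in A) a i <= \esum_(i in B) a i.
Proof.
move=> AB; apply: le_ereal_sup => _ [X [finX XA] <-]; exists X => //.
by split => //; exact: subset_trans AB.
Qed.

Lemma esum_setU_le (T : choiceType) (A B : set T) (a : T -> \bar R) :
  (forall i, 0 <= a i) ->
  \esum_(i in A `|` B) a i <= \esum_(i in A) a i + \esum_(i in B) a i.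
Proof.
move=> a0; rewrite (esumID A)//; apply: leeD; apply: esum_subset.
- by move=> i [].
- by move=> i [[]].
Qed.

(** [seqDU] makes the union disjoint, so that the sum splits exactly, and each disjoint piece is
    contained in [F k]. *)
Lemma esum_bigcup_le (T : choiceType) (F : (set T)^nat) (a : T -> \bar R) :
  (forall i, 0 <= a i) ->
  \esum_(i in \bigcup_k F k) a i <= \sum_(k <oo) \esum_(i in F k) a i.
Proof.
move=> a0; rewrite seqDU_bigcup_eq nneseries_sum_bigcup//.
apply: lee_nneseries => k _; first by move=> _; exact: esum_ge0.
by apply: esum_subset; apply: subset_seqDU.
Qed.

Lemma esumZl_le (T : choiceType) (D : set T) (c : R) (a : T -> \bar R) :
  (0 <= c)%R -> (forall i, 0 <= a i) ->
  \esum_(i in D) (c%:E * a i) <= c%:E * \esum_(i in D) a i.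
Proof.
move=> c0 a0; apply: ge_ereal_sup => _ [X [finX XD] <-].
rewrite -ge0_mule_fsumr//; apply: lee_pmul => //.
  by apply: fsume_ge0.
by apply: ereal_sup_ubound; exists X.
Qed.

Lemma esumZl_ge (T : choiceType) (D : set T) (c : R) (a : T -> \bar R) :
  (0 < c)%R -> (forall i, 0 <= a i) ->
  c%:E * (\esum_(i in D) a i) <= \esum_(i in D) (c%:E * a i).
Proof.
move=> c0 a0; rewrite -lee_pdivlMl//; apply: le_trans (esumZl_le _ _ _).
- by apply: le_esum => i _; rewrite muleA -EFinM mulVf ?mul1e// gt_eqF.
- by rewrite invr_ge0 ltW.
- by move=> i; rewrite mule_ge0// lee_fin ltW.
Qed.

(** As [f] need not be injective, one preimage of each image point is kept. On these [f] is
    injective, and the remaining indices only enlarge the right-hand side. *)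
Lemma esum_image_le (T T' : choiceType) (P : set T) (f : T -> T')
    (a : T' -> \bar R) : (forall i, 0 <= a i) ->
  \esum_(j in f @` P) a j <= \esum_(i in P) a (f i).
Proof.
move=> a0; have [->|/set0P[i0 Pi0]] := eqVneq P set0.
  by rewrite image_set0 !esum_set0.
have /choice[g gP] : forall j, exists i, (f @` P) j -> P i /\ f i = j.
  by move=> j; have [[i Pi <-]|nj] := pselect ((f @` P) j); [exists i|exists i0].
have gK : f @` P = f @` (g @` (f @` P)).
  apply/seteqP; split=> [j Pj|_ [_ [j Pj <-] <-]].
    by exists (g j); [exists j|have [] := gP _ Pj].
  by have [Pg _] := gP _ Pj; exists (g j).
rewrite gK esum_image; last first.
  move=> _ _ /set_mem[j Pj <-] /set_mem[k Pk <-].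
  by have [_ ->] := gP _ Pj; have [_ ->] := gP _ Pk => ->.
by apply: esum_subset => _ [j /gP[Pg _] <-].
Qed.

Lemma measure_bigcup_le_esum d (T : measurableType d) (mu : {measure set T -> \bar R})
    (D : set nat) (F : (set T)^nat) : (forall n, measurable (F n)) ->
  mu (\bigcup_(n in D) F n) <= \esum_(n in D) mu (F n).
Proof.
move=> mF; rewrite bigcup_mkcond (esum_mkcond D) -nneseries_esumT; last first.
  by move=> n; case: ifP.
have mFD n : measurable (if n \in D then F n else set0) by case: ifP.
apply: le_trans (generalized_Boole_inequality mu mFD _) _.
  exact: bigcupT_measurable.
by apply: lee_nneseries => // n _; case: ifP => // _; rewrite measure0.
Qed.

End esum_extra.

(** * Dyadic grid balls *)

Section grid.
Context {R : realType} {d : nat}.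
Implicit Types (x y : 'rV[R]_d) (r : R) (q : nat).

Lemma closed_ballP x y r : 0 < r -> closed_ball x r y <-> `|x - y| <= r.
Proof. by move=> r0; rewrite closed_ballE. Qed.

Lemma rV_norm_leP x r : 0 <= r -> `|x| <= r <-> forall i, `|x 0 i| <= r.
Proof.
move=> r0; rewrite [(`|x|)]/Num.norm/= mx_normrE; split.
  by move=> /bigmax_leP[_ h] i; apply: (h (0, i)).
by move=> h; apply/bigmax_leP; split => // -[i j] _; rewrite ord1 /=.
Qed.

(** Pairs of a generation and a lattice point are numbered by naturals, so that a family of grid
    balls is a set of naturals, as in [ball_cover]. *)
Lemma grid_code_exists :
  exists f : nat -> nat * 'rV[int]_d, injective f /\ forall p, exists q, f q = p.
Proof.
have : ([set: nat * 'rV[int]_d] #= [set: nat])%card.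
  apply: eq_card_nat; first exact: countableP.
  move=> /(finite_image fst) fin1; apply: infinite_nat.
  by apply: sub_finite_set fin1 => n _; exists (n, 0).
move=> /card_set_bijP[g]; rewrite setTT_bijective => -[f gK fK]; exists f; split.
  exact: can_inj fK.
by move=> p; exists (g p).
Qed.

Definition grid_code : nat -> nat * 'rV[int]_d := projT1 (cid grid_code_exists).

Lemma grid_code_inj : injective grid_code.
Proof. by rewrite /grid_code; case: cid => /= f []. Qed.

Lemma grid_code_surj p : exists q, grid_code q = p.
Proof. by rewrite /grid_code; case: cid => /= f []. Qed.

Lemma finite_lattice_box (K : nat) :
  finite_set [set k : 'rV[int]_d | forall i, `|k 0 i| <= K%:Z].
Proof.
apply: (@sub_finite_set _ _ ((fun f : {ffun 'I_d -> 'I_(2 * K).+1} =>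
  \row_i ((f i : nat)%:Z - K%:Z)) @` setT)); last exact: finite_image.
move=> k kK; exists [ffun i => inord `|(k 0 i + K%:Z)%R|%N] => //.
apply/rowP => i; have ki : `|k 0 i| <= K%:Z := kK i.
by rewrite mxE ffunE inordK; lia.
Qed.

Definition gen q := (grid_code q).1.
Definition mesh q : R := 2^-1 ^+ gen q.
Definition center q : 'rV[R]_d := \row_i (mesh q * ((grid_code q).2 0 i)%:~R).
(* A set of diameter at most [mesh q] lies in some [gball q]; a ball that meets [gball q] without
   being contained in [gball2 q] has radius at least [mesh q]. *)
Definition gball q := closed_ball (center q) (2 * mesh q).
Definition gball2 q := closed_ball (center q) (4 * mesh q).

Lemma mesh_gt0 q : 0 < mesh q. Proof. by rewrite exprn_gt0// invr_gt0. Qed.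
Lemma mesh_le1 q : mesh q <= 1.
Proof. by rewrite exprn_ile1// ?invr_ge0// invf_le1// ler1n. Qed.

Lemma gballP q x : gball q x <-> `|center q - x| <= 2 * mesh q.
Proof. by apply: closed_ballP; have := mesh_gt0 q; lra. Qed.

Lemma gball2P q x : gball2 q x <-> `|center q - x| <= 4 * mesh q.
Proof. by apply: closed_ballP; have := mesh_gt0 q; lra. Qed.

(** Rounding the centre down to the lattice moves it by at most one mesh, and the radius costs
    another; hence the factor 2 in [gball]. *)
Lemma closed_ball_sub_gball x r n : 0 < r -> r <= 2^-1 ^+ n ->
  exists2 q, gen q = n & closed_ball x r `<=` gball q.
Proof.
move=> r0 rn; pose u : R := 2^-1 ^+ n.
have u0 : 0 < u by rewrite exprn_gt0// invr_gt0.
have [q qE] := grid_code_surj (n, \row_i Num.floor (x 0 i / u)).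
have qn : gen q = n by rewrite /gen qE.
exists q => // y /(closed_ballP _ _ r0) xy; apply/gballP.
have -> : center q - y = (center q - x) + (x - y) by rewrite addrA subrK.
apply: le_trans (ler_normD _ _) _.
have -> : 2 * mesh q = u + u by rewrite /mesh qn -/u; ring.
apply: lerD; last exact: le_trans xy rn.
apply/rV_norm_leP => [|i]; first exact: ltW.
rewrite !mxE qE/= mxE /mesh qn -/u.
have := floor_itv (x 0 i / u); rewrite ler_pdivlMr// ltr_pdivrMr// intrD.
move=> /andP[h1 h2]; rewrite ler_norml; apply/andP; split; nra.
Qed.

Lemma finite_gens (n : nat) (A : set 'rV[R]_d) : bounded_set A ->
  finite_set [set q | (gen q <= n)%N /\ gball2 q `&` A !=set0].
Proof.
move=> bA; have {bA}[M M0 AM] : exists2 M : R, 0 <= M & forall x, A x -> `|x| <= M.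
  have [M [_ AM]] := bA; exists (`|M| + 1) => [|x Ax].
    exact: addr_ge0.
  by apply: AM => //; rewrite (le_lt_trans (ler_norm M))// ltrDl.
(* Meshes are at most 1, so the relevant centres have norm at most [M + 4]; dividing by a mesh of at
   least 2^-n bounds their lattice coordinates by [K]. *)
set K := (M + 4) * 2 ^+ n.
apply: (@sub_finite_set _ _ (grid_code @^-1`
    (`I_n.+1 `*` [set k : 'rV[int]_d | forall i, `|k 0 i| <= (Num.truncn K).+1%:Z]))).
  move=> q [qn [x [/gball2P xq Ax]]]; split => //= i.
  have cM : `|center q| <= M + 4.
    rewrite -[center q](subrK x); apply: le_trans (ler_normD _ _) _.
    by have := AM _ Ax; have := mesh_le1 q; lra.
  have := (rV_norm_leP _ (le_trans (normr_ge0 _) cM)).1 cM i.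
  rewrite mxE normrM gtr0_norm ?mesh_gt0// -(ler_int R).
  have ->: mesh q = (2 ^+ gen q)^-1 by rewrite /mesh exprVn.
  rewrite ler_pdivrMl ?exprn_gt0// intr_norm => h.
  apply/ltW/(le_lt_trans h)/(@le_lt_trans _ _ K); last first.
    exact: real_truncnS_gt (num_real _).
  rewrite /K mulrC ler_wpM2l//; first by lra.
  by rewrite ler_weXn2l// ler1n.
apply: finite_preimage; first by move=> p q _ _; exact: grid_code_inj.
by apply: finite_setX; [exact: finite_II|exact: finite_lattice_box].
Qed.

(* Along each coordinate, go from a common point towards the centre of the ball
   until the next lattice coordinate. *)
Lemma lattice_point x r q : 0 < r -> mesh q <= r ->
  closed_ball x r `&` gball q !=set0 ->
  exists k : 'rV[int]_d, closed_ball x r (\row_i (mesh q * (k 0 i)%:~R)) /\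
    forall i, `|k 0 i - (grid_code q).2 0 i| <= 3.
Proof.
move=> r0 ur [y [/(closed_ballP _ _ r0) xy /gballP qy]].
have u0 : 0 < mesh q := mesh_gt0 q.
have {}xy := (rV_norm_leP _ (ltW r0)).1 xy.
have {}qy := (rV_norm_leP _ (ltW (mulr_gt0 (ltr0Sn _ 1) u0))).1 qy.
exists (\row_i (Num.floor (y 0 i / mesh q) + (y 0 i <= x 0 i)%R%:Z)).
split=> [|i].
  apply/(closed_ballP _ _ r0)/rV_norm_leP => [|i]; first exact: ltW.
  have := xy i; have := floor_itv (y 0 i / mesh q).
  rewrite ler_pdivlMr// ltr_pdivrMr// !mxE !intrD => /andP[h1 h2].
  rewrite !ler_norml => /andP[h3 h4].
  by case: (leP (y 0 i) (x 0 i)) => h5; rewrite /= ?mulr1z ?mulr0z; apply/andP; split; nra.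
have := qy i; have := floor_itv (y 0 i / mesh q).
rewrite ler_pdivlMr// ltr_pdivrMr// !mxE intrD => /andP[h1 h2].
rewrite !ler_norml => /andP[h3 h4].
set a := Num.floor _ in h1 h2 *; set c := (grid_code q).2 0 i in h3 h4 *.
have h5 : (a%:~R : R) - c%:~R <= 2 by nra.
have h6 : -3 < (a%:~R : R) - c%:~R by nra.
have {}h5 : a - c <= 2 by rewrite -(ler_int R) intrB.
have {}h6 : -3 < a - c by rewrite -(ltr_int R) intrB.
by case: (y 0 i <= x 0 i); apply/andP; split; lia.
Qed.

Lemma ball_meets_gball x r q : 0 < r -> closed_ball x r `&` gball q !=set0 ->
  ~ closed_ball x r `<=` gball2 q -> mesh q <= r.
Proof.
move=> r0 [y [/(closed_ballP _ _ r0) xy /gballP qy]] nsub.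
rewrite leNgt; apply/negP => ru; apply: nsub => z /(closed_ballP _ _ r0) xz.
apply/gball2P.
have -> : center q - z = (center q - y) - (x - y) + (x - z).
  by rewrite opprB !addrA !subrK.
apply: le_trans (ler_normD _ _) _.
have := ler_normB (center q - y) (x - y); lra.
Qed.
End grid.

Lemma half_powR_small (R : realType) (t c : R) : 0 < t -> 0 < c ->
  exists a : nat, forall n, (a <= n)%N -> (2^-1 ^+ n) `^ t <= c.
Proof.
move=> t0 c0; pose z : R := 2^-1 `^ t.
have z0 : 0 <= z by exact: powR_ge0.
have z1 : z < 1.
  have := @gt0_ltr_powR R t t0 2^-1 1; rewrite powR1 !nnegrE; apply => //.
  by rewrite invf_lt1// ltr1n.
have zE n : (2^-1 ^+ n) `^ t = z ^+ n.
  by rewrite -powR_mulrn ?invr_ge0// -powRrM mulrC powRrM powR_mulrn// powR_ge0.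
have : z ^+ n @[n --> \oo] --> 0 by apply: cvg_expr; rewrite ger0_norm.
move=> /cvgrPdist_le /(_ _ c0)[a _ ha]; exists a => n an.
by have := ha n an; rewrite zE/= sub0r normrN ger0_norm// exprn_ge0.
Qed.

(** * Measure of grid balls and the lower Hausdorff dimension *)

Section borel_probability.
Context {R : realType} {d : nat} (mu : probability (borelRV R d) R).
Local Notation gen := (@gen d).
Local Notation mesh := (@mesh R d).
Local Notation gball := (@gball R d).
Local Notation gball2 := (@gball2 R d).
Local Notation m A := (fine (mu A)).
Implicit Types A D E F G : set (borelRV R d).

Lemma open_borel A : open (A : set 'rV[R]_d) -> measurable A.
Proof. by move=> oA; exact: sub_sigma_algebra. Qed.

Lemma closed_borel A : closed (A : set 'rV[R]_d) -> measurable A.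
Proof. by rewrite -openC => /open_borel /measurableC; rewrite setCK. Qed.

Lemma closed_ball_borel (x : 'rV[R]_d) r : measurable (closed_ball x r : set (borelRV R d)).
Proof. by apply: closed_borel; exact: closed_ball_closed. Qed.

Lemma gball2_borel q : measurable (gball2 q : set (borelRV R d)).
Proof. exact: closed_ball_borel. Qed.

Lemma bigcup_gball2_borel (S : set nat) :
  measurable (\bigcup_(q in S) gball2 q : set (borelRV R d)).
Proof. by apply: bigcup_measurable => q _; exact: gball2_borel. Qed.

Lemma fine_mu A : measurable A -> mu A = (m A)%:E.
Proof. by move=> mA; rewrite fineK// fin_num_measure. Qed.

Lemma m_ge0 A : 0 <= m A. Proof. exact/fine_ge0. Qed.

Lemma le_m A D : measurable A -> measurable D -> A `<=` D -> m A <= m D.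
Proof.
by move=> mA mD AD; rewrite fine_le ?fin_num_measure// le_measure ?inE.
Qed.

Lemma m_setD A D : measurable A -> measurable D -> D `<=` A -> m (A `\` D) = m A - m D.
Proof.
move=> mA mD DA; rewrite measureD//.
  by rewrite setIidr// fineB ?fin_num_measure.
exact: le_lt_trans (probability_le1 mu mA) (ltry 1).
Qed.

Lemma mu_setU_le A D : measurable A -> measurable D -> (mu (A `|` D) <= mu A + mu D)%E.
Proof. exact: measureU2. Qed.

Lemma mu_bigcup_le (S : set nat) (F : nat -> set (borelRV R d)) :
  (forall n, measurable (F n)) ->
  (mu (\bigcup_(n in S) F n) <= \esum_(n in S) (m (F n))%:E)%E.
Proof.
move=> mF; apply: le_trans (measure_bigcup_le_esum _ _ mF) _.
by apply: le_esum => n _; rewrite -fine_mu.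
Qed.

(** Upper semicontinuity: the balls [F n] decrease to the closed ball, so one of them still has
    measure below [c], and it contains the balls of radius [r] around all points near [x]. This
    makes the sets in [frostman_exists] measurable. *)
Lemma open_lt_mu_closed_ball (r c : R) : 0 < r ->
  open [set x : 'rV[R]_d | (mu (closed_ball x r) < c%:E)%E].
Proof.
have op (A : set 'rV[R]_d) : (forall x, A x -> nbhs x A) -> open A by rewrite openE.
move=> r0; apply: op => x /= xc; pose F n := closed_ball x (r + n.+1%:R^-1).
have Fr n : 0 < r + n.+1%:R^-1 by rewrite addr_gt0.
have capF : \bigcap_n F n = closed_ball x r.
  apply/seteqP; split=> [y Fy|y].
    apply/(closed_ballP _ _ r0)/ler_addgt0Pr => e e0.
    have [n _ /(_ n)/= ne] := near_infty_natSinv_lt (PosNum e0).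
    have /(closed_ballP _ _ (Fr n)) := Fy n I.
    by move/le_trans; apply; rewrite lerD2l ltW// ne.
  move=> /(closed_ballP _ _ r0) xy n _; apply/(closed_ballP _ _ (Fr n)).
  by rewrite (le_trans xy)// lerDl.
have : mu (F n) @[n --> \oo] --> mu (closed_ball x r).
  rewrite -capF; apply: nonincreasing_cvg_mu.
  - exact: le_lt_trans (probability_le1 mu (closed_ball_borel x _)) (ltry 1).
  - by move=> n; exact: closed_ball_borel.
  - by rewrite capF; exact: closed_ball_borel.
  - move=> n k nk; apply/subsetPset => y /(closed_ballP _ _ (Fr k)) h.
    apply/(closed_ballP _ _ (Fr n)); rewrite (le_trans h)// lerD2l.
    by rewrite lef_pV2 ?posrE// ler_nat.
have xcn : nbhs (mu (closed_ball x r)) [set y | (y < c%:E)%E].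
  by apply: open_nbhs_nbhs; split => //; exact: open_ereal_lt_ereal.
move=> /(_ _ xcn)[n _ /(_ n (leqnn n)) Fn].
apply/nbhs_ballP; exists n.+1%:R^-1 => /= [|y]; first by [].
rewrite -ball_normE /= => xy; apply: le_lt_trans Fn.
apply: le_measure; rewrite ?inE; [exact: closed_ball_borel..|].
move=> z /(closed_ballP _ _ r0) yz; apply/(closed_ballP _ _ (Fr n)).
have -> : x - z = (y - z) + (x - y) by rewrite [RHS]addrC addrA subrK.
by rewrite (le_trans (ler_normD _ _))// lerD// ltW.
Qed.

(* Outside a set of small measure, grid balls of generation at least [a] satisfy a Frostman
   bound of exponent [t]. *)
Definition frostman (t dl : R) (a : nat) :=
  exists G, [/\ measurable G, m (~` G) <= dl & forall q, (a <= gen q)%N ->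
    gball2 q `&` G !=set0 -> m (gball2 q) <= dl * mesh q `^ t].

(** The grid balls that meet [G] have total measure at most [dl] by the Frostman bound; the others
    lie in the complement of [G], which has measure at most [dl]. *)
Lemma frostman_bigcup t dl a (S : set nat) : 0 <= dl -> frostman t dl a ->
  (forall q, S q -> (a <= gen q)%N) ->
  (\esum_(q in S) (mesh q `^ t)%:E <= 1)%E ->
  m (\bigcup_(q in S) gball2 q) <= 2 * dl.
Proof.
move=> dl0 [G [mG Gdl Gq]] Sa S1.
pose S' := S `&` [set q | gball2 q `&` G !=set0].
have mS' := bigcup_gball2_borel S'; have mS := bigcup_gball2_borel S.
rewrite -lee_fin -fine_mu//.
have -> : (2 * dl)%:E = (dl%:E + dl%:E)%E by rewrite -EFinD; congr EFin; ring.
have mGC := measurableC mG.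
apply: (@le_trans _ _ (mu (~` G `|` \bigcup_(q in S') gball2 q))).
  apply: le_measure; rewrite ?inE//; first exact: measurableU.
  move=> x [q Sq qx]; have [Gx|] := pselect (G x); last by left.
  by right; exists q => //; split => //; exists x.
apply: le_trans (mu_setU_le _ _) _ => //; apply: leeD.
  by rewrite fine_mu// lee_fin.
apply: le_trans (mu_bigcup_le _ gball2_borel) _.
apply: (@le_trans _ _ (\esum_(q in S) (dl%:E * (mesh q `^ t)%:E))%E).
  apply: le_trans (le_esum _) (esum_subset _ (@subIsetl _ _ _)).
  by move=> q [Sq Gq']; rewrite -EFinM lee_fin Gq//; exact: Sa.
apply: le_trans (esumZl_le _ _ _) _ => //.
  by move=> q; rewrite lee_fin powR_ge0.
by rewrite -[leRHS]mule1 lee_wpmul2l// lee_fin.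
Qed.

(** The lower limit is a supremum of infima over neighbourhoods, one of which exceeds [t].
    Multiplying by [ln r < 0] reverses the inequality; balls of measure zero are set apart because
    [lne] is infinite there. *)
Lemma local_dim_decay (t : R) (x : 'rV[R]_d) : (t%:E < lower_local_dim mu x)%E ->
  exists2 e : R, 0 < e & forall r, 0 < r -> r < e -> m (closed_ball x r) <= r `^ t.
Proof.
rewrite /lower_local_dim limf_einfE => /ereal_sup_gt[_ [V V0 <-] tV].
have /nbhs_ballP[e /= e0 eV] := V0.
exists (Num.min e 1) => [|r r0]; first by rewrite lt_min e0/=.
rewrite lt_min => /andP[re r1].
have Vr : V r by apply: eV => //; rewrite -ball_normE /= sub0r normrN gtr0_norm.
have /ltW := lt_le_trans tV (ereal_inf_lbound (ex_intro2 _ _ r Vr erefl)).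
have lnr : ln r < 0 by rewrite ln_lt0// r0.
rewrite fine_mu; last exact: closed_ball_borel.
have := m_ge0 (closed_ball x r); rewrite le_eqVlt => /predU1P[<- _|p0].
  exact: powR_ge0.
rewrite lne_EFin// -EFinM lee_fin ler_ndivlMr// => h.
by rewrite -ler_ln ?posrE ?powR_gt0// ln_powR.
Qed.

(** Almost every point has local dimension above some [t' > t], and the slack [t' - t] absorbs all
    constants at small scales. Hence the sets [G a] increase to a set of full measure. *)
Lemma frostman_exists (t dl : R) : 0 < t -> 0 < dl ->
  (t%:E < lower_hausdorff_dim mu)%E -> exists a, forall b, (a <= b)%N -> frostman t dl b.
Proof.
move=> t0 dl0 tdim; pose u n : R := 2^-1 ^+ n.
have u0 n : 0 < u n by rewrite exprn_gt0// invr_gt0.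
have [t' tt' t'dim] : exists2 t', t < t' & (t'%:E < lower_hausdorff_dim mu)%E.
  case: (lower_hausdorff_dim mu) tdim => [s|_|//].
    by rewrite lte_fin => ts; exists ((t + s) / 2); rewrite ?lte_fin; lra.
  by exists (t + 1); rewrite ?ltry// ltrDl.
(* Radius 8 meshes: a ball [gball2 q] of radius 4 meshes lies in the ball of this radius around any
   of its points. *)
pose O n := [set x : borelRV R d |
  (mu (closed_ball (x : 'rV[R]_d) (8 * u n)) < (dl * u n `^ t)%:E)%E].
have mO n : measurable (O n).
  by apply: open_borel; apply: open_lt_mu_closed_ball; rewrite mulr_gt0.
pose G a := \bigcap_(n in [set n | (a <= n)%N]) O n.
have mG a : measurable (G a) by apply: bigcap_measurableType => n _.
have mGU : measurable (\bigcup_a G a) by exact: bigcupT_measurable.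
have GU1 : mu (\bigcup_a G a) = 1%E.
  have mGUC := measurableC mGU.
  rewrite -(setCK (\bigcup_a G a)) probability_setC//.
  have [N [mN N0 GN]] := ess_inf_le mu (lower_local_dim mu).
  have -> : mu (~` (\bigcup_a G a)) = 0%E.
    apply/eqP; rewrite eq_le measure_ge0 andbT -N0 le_measure ?inE//.
    apply: subset_trans GN; apply: subsetC => x /=.
    move=> /(lt_le_trans t'dim) /local_dim_decay[e e0 he].
    have [a1 ha1] := half_powR_small (ltr01 : 0 < 1 :> R) (divr_gt0 e0 (ltr0Sn _ 15)).
    have c0 : 0 < dl / (2 * 8 `^ t') by rewrite divr_gt0// mulr_gt0// powR_gt0.
    have tt'0 : 0 < t' - t by rewrite subr_gt0.
    have [a2 ha2] := half_powR_small tt'0 c0.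
    exists (maxn a1 a2) => //= n; rewrite /= geq_max => /andP[a1n a2n].
    rewrite /O /= fine_mu; last exact: closed_ball_borel.
    have := ha1 n a1n; rewrite powRr1 ?(ltW (u0 n))// => un.
    rewrite lte_fin; apply: (@le_lt_trans _ _ ((8 * u n) `^ t')).
      by apply: he; [rewrite mulr_gt0|have := u0 n; rewrite /u in un *; lra].
    rewrite powRM ?(ltW (u0 n))//.
    have -> : u n `^ t' = u n `^ (t' - t) * u n `^ t.
      by rewrite -powRD ?subrK// (gt_eqF (u0 n)) implybT.
    rewrite mulrA ltr_pM2r ?powR_gt0//.
    apply: (@le_lt_trans _ _ (dl / 2)); last by lra.
    have := ha2 n a2n; rewrite ler_pdivlMr ?mulr_gt0 ?powR_gt0// -/(u n).
    set A := 8 `^ t'; set D := u n `^ _; nra.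
  by rewrite sube0.
have cG : mu (G a) @[a --> \oo] --> 1%E.
  rewrite -GU1; apply: nondecreasing_cvg_mu => // a b ab; apply/subsetPset.
  by move=> x Gx n bn; apply: Gx => /=; exact: leq_trans bn.
have n1 : nbhs (1%E : \bar R) [set y | ((1 - dl)%:E < y)%E].
  apply: open_nbhs_nbhs; split; first exact: open_ereal_gt_ereal.
  by rewrite /= lte_fin; lra.
have [a _ /(_ a (leqnn a)) Ga] := cG _ n1.
have {}Ga : ((1 - dl)%:E < mu (G a))%E := Ga.
exists a => b ab; exists (G a); split => //.
  have -> : m (~` G a) = 1 - m (G a) by rewrite probability_setC// (fine_mu (mG a)).
  by move: Ga; rewrite (fine_mu (mG a)) lte_fin /=; lra.
move=> q bq [y [/gball2P qy Gy]].
have := Gy (gen q) (leq_trans ab bq); rewrite /O/= fine_mu; last exact: closed_ball_borel.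
rewrite lte_fin => /ltW; apply: le_trans.
apply: le_m; [exact: gball2_borel|exact: closed_ball_borel|].
move=> z /gball2P qz; apply/closed_ballP; first by rewrite mulr_gt0.
have -> : y - z = (center q - z) - (center q - y) by rewrite opprB [RHS]addrC addrA subrK.
by apply: le_trans (ler_normB _ _) _; rewrite /mesh -/(u _) in qy qz *; lra.
Qed.

End borel_probability.

(** * Counting disjoint balls that meet a grid ball *)

Section counting.
Context {R : realType} {d : nat}.
Local Notation gen := (@gen d).
Local Notation mesh := (@mesh R d).
Local Notation gball := (@gball R d).

Definition lattice_box3 : set 'rV[int]_d := [set k | forall i, `|k 0 i| <= 3].

(** This number is 7^d. *)
Definition multiplicity : nat := #|` fset_set lattice_box3|.

Lemma multiplicity_gt0 : (0 < multiplicity)%N.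
Proof.
rewrite cardfs_gt0; apply/fset0Pn; exists 0.
rewrite in_fset_set; last exact: finite_lattice_box.
by apply/mem_set => i /=; rewrite mxE normr0.
Qed.

(** By [lattice_point] each ball contains a lattice point at most 3 steps per coordinate from the
    centre of [gball q]; disjoint balls get distinct lattice points. *)
Lemma card_balls_meeting (F : set nat) (x : nat -> 'rV[R]_d) (r : nat -> R) q :
  finite_set F -> trivIset F (fun n => closed_ball (x n) (r n)) ->
  (forall n, F n -> [/\ 0 < r n, mesh q <= r n & closed_ball (x n) (r n) `&` gball q !=set0]) ->
  (#|` fset_set F| <= multiplicity)%N.
Proof.
move=> finF trivF FP.
have /choice[k kP] : forall n, exists k : 'rV[int]_d, F n ->
    closed_ball (x n) (r n) (\row_i (mesh q * (k 0 i)%:~R)) /\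
    forall i, `|k 0 i - (grid_code q).2 0 i| <= 3.
  move=> n; have [Fn|] := pselect (F n); last by exists 0.
  by have [r0 ur xq] := FP n Fn; have [k ?] := lattice_point r0 ur xq; exists k.
pose f n := k n - (grid_code q).2.
have finj : {in fset_set F &, injective f}.
  move=> i j; rewrite !in_fset_set// => /set_mem Fi /set_mem Fj /addIr kij.
  apply: trivF => //; exists (\row_l (mesh q * (k i 0 l)%:~R)); split.
    by have [] := kP i Fi.
  by rewrite kij; have [] := kP j Fj.
rewrite -(card_in_imfset imfset_key finj); apply/fsubset_leq_card/fsubsetP => y /imfsetP[n /=].
rewrite in_fset_set// => /set_mem Fn ->; rewrite in_fset_set; last exact: finite_lattice_box.
by apply/mem_set => i; rewrite !mxE; have [_] := kP n Fn.
Qed.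

(** After exchanging the sums, each [q] is counted once for every ball charged with it, that is at
    most [multiplicity] times. *)
Lemma esum_balls_meeting (F : set nat) (x : nat -> 'rV[R]_d) (r : nat -> R)
    (S : set nat) (T : nat -> set nat) (w : nat -> R) :
  finite_set F -> trivIset F (fun n => closed_ball (x n) (r n)) ->
  (forall n, F n -> 0 < r n) -> (forall q, 0 <= w q) ->
  (forall n q, F n -> T n q ->
    [/\ S q, mesh q <= r n & closed_ball (x n) (r n) `&` gball q !=set0]) ->
  (\esum_(n in F) \esum_(q in T n) (w q)%:E <=
    multiplicity%:R%:E * \esum_(q in S) (w q)%:E)%E.
Proof.
move=> finF trivF r0 w0 TP.
rewrite esum_fset//; last by move=> n _; apply: esum_ge0 => q _; rewrite lee_fin.
rewrite fsbig_finite//=.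
have TS n : n \in fset_set F -> (\esum_(q in T n) (w q)%:E =
    \esum_(q in S) (if q \in T n then w q else 0)%:E)%E.
  rewrite in_fset_set// => /set_mem Fn.
  rewrite (_ : T n = S `&` T n); last first.
    by apply/seteqP; split => [q Tq|q []//]; split => //; have [] := TP n q Fn Tq.
  rewrite esum_mkcondr; apply: eq_esum => q Sq.
  by rewrite in_setI (mem_set Sq)/=; case: ifP.
rewrite big_seq (eq_bigr _ TS) -big_seq -esum_sum; last first.
  by move=> q n _ _; case: ifP; rewrite lee_fin.
apply: le_trans (esumZl_le _ _ _); rewrite ?ler0n//.
apply: le_esum => q Sq; rewrite sumEFin -big_mkcond/= -EFinM lee_fin.
rewrite big_const_seq iter_addr_0 -[leLHS]mulr_natl ler_wpM2r// ler_nat.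
rewrite -size_filter; pose Fq := F `&` [set n | T n q].
have finFq : finite_set Fq by exact: finite_setIl.
apply: (@leq_trans #|` fset_set Fq|).
  have uq : uniq [seq n <- fset_set F | q \in T n] by apply/filter_uniq/fset_uniq.
  rewrite -(undup_id uq) -card_fseq.
  apply/fsubset_leq_card/fsubsetP => n; rewrite in_fset mem_filter !in_fset_set//.
  by move=> /andP[/set_mem Tn /set_mem Fn]; apply/mem_set.
apply: (card_balls_meeting (x := x) (r := r) (q := q)) => //.
  by apply: sub_trivIset trivF; exact: subIsetl.
by move=> n [Fn Tn]; have [_ ? ?] := TP n q Fn Tn; split => //; exact: r0.
Qed.

End counting.

(** * Exhausting open sets by disjoint balls *)

Section vitali.
Context {R : realType} {d : nat} (mu : probability (borelRV R d) R).
Local Notation m A := (fine (mu A)).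
Context (B : nat -> set 'rV[R]_d) (x : nat -> 'rV[R]_d) (r : nat -> R).
Context (BE : forall n, B n = closed_ball (x n) (r n)).

(** What finitely many closed balls leave of an open set is open, so the covering property applies
    to it again; each round multiplies the uncovered measure by at most [1 - c]. *)
Lemma covering_exhausts (N : set nat) (Om : set 'rV[R]_d) (g : nat) (e : R) :
  asymptotically_covering mu B N -> open Om -> 0 < e ->
  exists F : set nat, [/\ finite_set F, F `<=` N,
    forall n, F n -> (g <= n)%N /\ B n `<=` Om, trivIset F B &
    m (Om `\` \bigcup_(n in F) B n) <= e].
Proof.
(* The cap at 1/2 keeps [1 - c] in [1/2, 1), so that its powers are positive and tend to 0. *)
move=> [C C0 CP] oOm e0; pose c := Num.min C 2^-1.
have c0 : 0 < c by rewrite lt_min C0/= invr_gt0 ltr0n.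
have c1 : c <= 2^-1 by rewrite ge_min lexx orbT.
have cC : c <= C by rewrite ge_min lexx.
have mB n : measurable (B n : set (borelRV R d)) by rewrite BE; exact: closed_ball_borel.
have mUB F : measurable (\bigcup_(n in F) B n : set (borelRV R d)).
  by apply: bigcup_measurable => n _; exact: mB.
have cUB F : finite_set F -> closed (\bigcup_(n in F) B n).
  by move=> finF; apply: closed_bigcup => // n _; rewrite BE; exact: closed_ball_closed.
have [k ke] : exists k, (1 - c) ^+ k <= e.
  have : (1 - c) ^+ n @[n --> \oo] --> 0.
    by apply: cvg_expr; rewrite ger0_norm; lra.
  move=> /cvgrPdist_le /(_ _ e0)[k _ /(_ k (leqnn k))] h; exists k.
  by apply: le_trans h; rewrite sub0r normrN ler_norm.
suff [F [? ? ? ? h]] : exists F : set nat, [/\ finite_set F, F `<=` N,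
    forall n, F n -> (g <= n)%N /\ B n `<=` Om, trivIset F B &
    m (Om `\` \bigcup_(n in F) B n) <= (1 - c) ^+ k].
  by exists F; split => //; exact: le_trans ke.
elim: k {ke} => [|k [F [finF FN FP tF Fk]]].
  exists set0; split => //; rewrite expr0 bigcup_set0 setD0.
  by rewrite -lee_fin -fine_mu ?probability_le1//; exact: open_borel.
pose Om' := Om `\` \bigcup_(n in F) B n.
have oOm' : open Om' by apply: openI => //; rewrite openC; exact: cUB.
have [F' [finF' F'N F'P tF' F'm]] := CP Om' g oOm'.
exists (F `|` F'); split.
- by rewrite finite_setU.
- by move=> n [/FN|/F'N].
- move=> n [/FP//|/F'P[gn nOm']]; split => //.
  by apply: subset_trans nOm' _; exact: subDsetl.
- move=> i j Fi Fj [y [Biy Bjy]]; move: Fi Fj => [Fi|Fi] [Fj|Fj].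
  + by apply: tF => //; exists y.
  + by have [_ /(_ y Bjy)[_ []]] := F'P j Fj; exists i.
  + by have [_ /(_ y Biy)[_ []]] := F'P i Fi; exists j.
  + by apply: tF' => //; exists y.
have mOm' : measurable (Om' : set (borelRV R d)) by exact: open_borel.
have F'Om' : \bigcup_(n in F') B n `<=` Om'.
  by move=> y [n F'n Bny]; have [_ ] := F'P n F'n; exact.
rewrite bigcup_setU -setDDl -/Om'.
set W := \bigcup_(n in F') B n in F'm F'Om' *.
have mW : measurable (W : set (borelRV R d)) by exact: mUB.
have WE : m (Om' `\` W) = m Om' - m W by exact: m_setD.
move: F'm; rewrite (fine_mu mu mOm') (fine_mu mu mW) -EFinM lee_fin => F'm.
have m0 := m_ge0 mu Om'.
apply: (@le_trans _ _ ((1 - c) * m Om')); last by rewrite exprS ler_wpM2l//; lra.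
rewrite WE; have := ler_wpM2r m0 cC; lra.
Qed.

End vitali.

(** * Selecting a ball that is cheap to meet *)

Section selection.
Context {R : realType} {d : nat} (mu : probability (borelRV R d) R).
Local Notation gen := (@gen d).
Local Notation mesh := (@mesh R d).
Local Notation gball := (@gball R d).
Local Notation gball2 := (@gball2 R d).
Local Notation m A := (fine (mu A)).
Context (B U : nat -> set 'rV[R]_d) (x : nat -> 'rV[R]_d) (r : nat -> R).
Context (r_gt0 : forall n, 0 < r n).
Context (BE : forall n, B n = closed_ball (x n) (r n)).
Context (U_sub_B : forall n, U n `<=` B n).

Definition meeting (S : set nat) (A : set 'rV[R]_d) : set nat :=
  S `&` [set q | gball q `&` A !=set0].

Lemma ball_borel n : measurable (B n : set (borelRV R d)).
Proof. by rewrite BE; exact: closed_ball_borel. Qed.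

(* The balls of [F] not contained in any [gball2 q] carry measure at least [e / 2]. If all of
   them violated the budget, summing over them would charge every [q] at most [multiplicity]
   times, contradicting the total weight 1. *)
Lemma select_ball (V : set 'rV[R]_d) (S F : set nat) (w : nat -> R) (e : R) :
  open V -> (forall q, 0 <= w q) -> (\esum_(q in S) (w q)%:E <= 1)%E -> 0 < e ->
  finite_set F -> trivIset F B -> (forall n, F n -> B n `<=` V) ->
  m (V `\` \bigcup_(n in F) B n) <= e / 2 ->
  e <= m (V `\` \bigcup_(q in meeting S V) gball2 q) ->
  exists2 n, F n & (forall q, meeting S (U n) q -> mesh q <= r n) /\
    (\esum_(q in meeting S (U n)) (w q)%:E <=
      (4 * (@multiplicity d)%:R / e * m (B n))%:E)%E.
Proof.
move=> oV w0 w1 e0 finF trivF FV FVe eV.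
pose K : R := (@multiplicity d)%:R.
have K0 : 0 < K by rewrite ltr0n multiplicity_gt0.
pose F' := F `&` [set n | forall q, meeting S V q -> ~ B n `<=` gball2 q].
have F'mesh n q : F' n -> meeting S (U n) q -> mesh q <= r n /\ B n `&` gball q !=set0.
  move=> [Fn nF] [Sq [y [qy Uy]]]; have By : B n y by exact: U_sub_B.
  have Bq : B n `&` gball q !=set0 by exists y.
  split => //; apply: (@ball_meets_gball _ _ (x n)); rewrite -?BE//.
  by apply: nF; split => //; exists y; split => //; exact: FV By.
apply: contrapT => noF.
have big n : F' n -> ((4 * K / e * m (B n))%:E <= \esum_(q in meeting S (U n)) (w q)%:E)%E.
  move=> F'n; rewrite leNgt; apply/negP => /ltW h; apply: noF; exists n; first by case: F'n.
  by split=> // q /(F'mesh n q F'n)[].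
have mV := open_borel oV.
have mF := bigcup_measurable (fun n (_ : F n) => ball_borel n).
have mF' := bigcup_measurable (fun n (_ : F' n) => ball_borel n).
have mS := bigcup_gball2_borel (meeting S V).
have eF' : e / 2 <= m (\bigcup_(n in F') B n).
  suff : m (V `\` \bigcup_(q in meeting S V) gball2 q) <=
      m (V `\` \bigcup_(n in F) B n) + m (\bigcup_(n in F') B n) by lra.
  rewrite -lee_fin EFinD -!fine_mu//; try exact: measurableD.
  apply: le_trans (mu_setU_le _ _ _) => //; last exact: measurableD.
  apply: le_measure; rewrite ?inE; try exact: measurableD.
    by apply: measurableU => //; exact: measurableD.
  move=> y [Vy nSy]; have [[n Fn Bny]|] := pselect ((\bigcup_(n in F) B n) y); last by left.
  right; exists n => //; split => // q Sq Bq; apply: nSy; exists q => //; exact: Bq.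
have : ((4 * K / e * (e / 2))%:E <= K%:E)%E.
  apply: (@le_trans _ _ ((4 * K / e)%:E * mu (\bigcup_(n in F') B n))%E).
    by rewrite fine_mu// -EFinM lee_fin ler_wpM2l// divr_ge0 ?mulr_ge0 ?ltW.
  apply: (@le_trans _ _ (\esum_(n in F') \esum_(q in meeting S (U n)) (w q)%:E)%E).
    apply: (@le_trans _ _ (\esum_(n in F') (4 * K / e * m (B n))%:E)%E); last first.
      exact: le_esum.
    under eq_esum do rewrite EFinM.
    apply: le_trans (esumZl_ge _ _ _).
    - apply: lee_wpmul2l; first by rewrite lee_fin ltW// divr_gt0// mulr_gt0.
      by apply: mu_bigcup_le; exact: ball_borel.
    - by rewrite divr_gt0// mulr_gt0.
    - by move=> n; rewrite lee_fin m_ge0.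
  apply: le_trans (esum_balls_meeting (F := F') (x := x) (r := r) (S := S) _ _ _ _ _) _ => //.
  - exact: finite_setIl.
  - by apply: sub_trivIset (_ : trivIset F _); [exact: subIsetl|under eq_fun do rewrite -BE].
  - by move=> n q F'n Tq; have [? ?] := F'mesh n q F'n Tq; split; [case: Tq|by []|rewrite -BE].
  by rewrite -[leRHS]mule1 lee_wpmul2l// lee_fin ltW.
rewrite lee_fin leNgt => /negP; apply.
have -> : 4 * K / e * (e / 2) = 2 * K by field; rewrite gt_eqF.
lra.
Qed.

End selection.

(** * Cheap covers miss a definite part of a set of large essential content *)

Section content_deficit.
Context {R : realType} {d : nat} (d_gt0 : (0 < d)%N) (mu : probability (borelRV R d) R).
Local Notation gen := (@gen d).
Local Notation mesh := (@mesh R d).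
Local Notation gball := (@gball R d).
Local Notation gball2 := (@gball2 R d).
Local Notation m A := (fine (mu A)).

(** For the sup norm the opposite corners [x + c] and [x - c] realise the diameter; [d_gt0] gives
    the constant vector [c] the norm [r]. *)
Lemma diam_closed_ball (x : 'rV[R]_d) (r : R) : 0 < r -> diam (closed_ball x r) = 2 * r.
Proof.
move=> r0; have r20 : 0 <= r by exact: ltW.
pose c : 'rV[R]_d := const_mx r.
have ballc y : `|y| = r -> closed_ball x r (x + y).
  by move=> yr; apply/(closed_ballP _ _ r0); rewrite opprD addNKr normrN yr.
have cr : `|c| = r.
  apply/eqP; rewrite eq_le; apply/andP; split.
    by apply/rV_norm_leP => // i; rewrite mxE ger0_norm.
  have /rV_norm_leP := lexx `|c|; move=> /(_ (normr_ge0 _) (Ordinal d_gt0)).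
  by rewrite mxE ger0_norm.
have ub : ubound [set `|y - z| | y in closed_ball x r & z in closed_ball x r] (2 * r).
  move=> _ [y /(closed_ballP _ _ r0) xy] [z /(closed_ballP _ _ r0) xz] <-.
  have -> : y - z = (x - z) - (x - y) by rewrite opprB [RHS]addrC addrA subrK.
  by apply: le_trans (ler_normB _ _) _; lra.
apply/eqP; rewrite eq_le; apply/andP; split.
  apply: ge_sup => //; exists `|x + c - (x + c)|, (x + c); first exact: ballc.
  by exists (x + c) => //; exact: ballc.
apply: ub_le_sup; first by exists (2 * r).
exists (x + c); first exact: ballc.
exists (x - c); first by apply: ballc; rewrite normrN.
have -> : x + c - (x - c) = 2 *: c.
  by apply/rowP => i; rewrite !mxE; ring.
by rewrite normrZ cr ger0_norm.
Qed.

Lemma diam_gball2 q : diam (gball2 q) = 8 * mesh q.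
Proof. by rewrite diam_closed_ball ?mulr_gt0 ?mesh_gt0//; ring. Qed.

(** For each [q] the ultrafilter contains either the indices whose set contains [q] or those whose
    set omits it; finitely many such members are intersected. *)
Lemma agree_on_finite (G : set_system nat) (Sf : nat -> set nat) (A : set nat) :
  UltraFilter G -> finite_set A ->
  G [set k | forall q, A q -> Sf k q <-> G [set j | Sf j q]].
Proof.
move=> UG /finite_fsetP[X ->].
pose J q := [set k | Sf k q <-> G [set j | Sf j q]].
suff : G (\bigcap_(q in [set` X]) J q) by apply: filterS => k h q Xq; exact: h.
apply: filter_bigI => q _; have [Gq|Gq] := in_ultra_setVsetC [set j | Sf j q] UG.
  by apply: filterS (Gq) => k Sk; split.
apply: filterS (Gq) => k nk; split => // Gq'; exfalso.
by have [j []] := filter_ex (filterI Gq Gq').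
Qed.

(* If the deficits were arbitrarily small, an ultrafilter would select covers [Sf (k i)] that
   agree on larger and larger sets of generations, so that their union costs little more than
   one of them although it covers almost all of [U]. *)
Lemma cover_deficit (x : 'rV[R]_d) (rB : R) (U : set 'rV[R]_d) (s t t' r h : R) :
  0 < rB -> open U -> U `<=` closed_ball x rB ->
  0 < m (closed_ball x rB) ->
  (mu (closed_ball x rB) <= ess_hausdorff_content mu s U)%E ->
  t < t' -> t' <= s -> 0 < t' -> 0 < r -> 8 * r <= 1 -> 0 <= h ->
  8 `^ t' * r `^ (t' - t) * h <= m (closed_ball x rB) / 2 ->
  exists2 e : R, 0 < e & forall S : set nat, (forall q, S q -> mesh q <= r) ->
    (\esum_(q in S) (mesh q `^ t)%:E <= h%:E)%E ->
    e <= m (U `\` \bigcup_(q in S) gball2 q).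
Proof.
move=> rB0 oU UB; set b := m (closed_ball x rB) => b0 bcont tt' t's t'0 r0 r8 h0 hb.
have bU : bounded_set U.
  exists (`|x| + rB); split; first exact: num_real.
  move=> M xM y /UB /(closed_ballP _ _ rB0) xy; apply: le_trans (ltW xM).
  rewrite -[y](subKr x); apply: le_trans (ler_normB _ _) _.
  by rewrite lerD2l.
have mU := open_borel oU.
apply: contrapT => noe.
(* Dropping the grid balls that miss the bounded set [U] leaves only finitely many up to any
   generation. *)
have /choice[Sf Sfp] : forall k, exists S : set nat,
    [/\ forall q, S q -> mesh q <= r /\ gball2 q `&` U !=set0,
        (\esum_(q in S) (mesh q `^ t)%:E <= h%:E)%E &
        m (U `\` \bigcup_(q in S) gball2 q) < 2^-1 ^+ k].
  move=> k; apply: contrapT => nS; apply: noe; exists (2^-1 ^+ k).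
    by rewrite exprn_gt0// invr_gt0.
  move=> S Sr Sh; rewrite leNgt; apply/negP => Sk; apply: nS.
  exists (S `&` [set q | gball2 q `&` U !=set0]); split.
  - by move=> q [Sq qU]; split => //; exact: Sr.
  - by apply: le_trans (esum_subset _ _) Sh; exact: subIsetl.
  - apply: le_lt_trans Sk; apply: le_m.
    + by apply: measurableD => //; exact: bigcup_gball2_borel.
    + by apply: measurableD => //; exact: bigcup_gball2_borel.
    move=> y [Uy nSy]; split => // -[q Sq qy]; apply: nSy; exists q => //.
    by split => //; exists y.
have [G [UG oG]] := ultraFilterLemma (@eventually_filter).
pose A n := [set q | (gen q <= n)%N /\ gball2 q `&` U !=set0].
have finA n : finite_set (A n) by exact: finite_gens.
have p8 : 0 < 8 `^ t' :> R by exact: powR_gt0.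
(* This value makes the tail [T i] below cost at most the share 2^-(i+1) of [b / 4]; [h + 1] guards
   against dividing by 0. *)
pose c i := b / 4 / (2 ^ i.+1)%:R / (8 `^ t' * (h + 1)).
have c0 i : 0 < c i.
  by rewrite /c !divr_gt0 ?ltr0n ?expn_gt0// mulr_gt0//; lra.
have gam0 : 0 < t' - t by rewrite subr_gt0.
have /choice[g gP] i := half_powR_small gam0 (c0 i).
(* [Sf (k i)] and [Sf (k i.+1)] both agree with the ultrafilter limit up to generation [g i], hence
   with each other; this is why each [k i] handles two bounds. *)
have /choice[k kP] : forall i, exists k, [/\ (i <= k)%N,
    forall q, A (g i) q -> Sf k q <-> G [set j | Sf j q] &
    forall q, A (g i.-1) q -> Sf k q <-> G [set j | Sf j q]].
  move=> i; have Gi : G [set k | (i <= k)%N] by apply: oG; exists i.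
  have [k [[? ?] ?]] := filter_ex (filterI (filterI Gi
    (agree_on_finite Sf UG (finA (g i)))) (agree_on_finite Sf UG (finA (g i.-1)))).
  by exists k.
pose T i := Sf (k i.+1) `&` [set q | (g i < gen q)%N].
have Tsub i : Sf (k i) `<=` Sf (k 0%N) `|` \bigcup_j T j.
  elim: i => [|i IH] q Sq; first by left.
  have [gq|gq] := ltnP (g i) (gen q); first by right; exists i.
  have [/(_ q Sq)[_ qU] _ _] := Sfp (k i.+1).
  have Aq : A (g i) q by [].
  apply: IH; have [_ h1 _] := kP i; have [_ _ h2] := kP i.+1.
  by apply/(h1 q Aq)/(h2 q Aq).
pose v q := (8 * mesh q) `^ s.
have v0 q : (0 <= (v q)%:E)%E by rewrite lee_fin powR_ge0.
have vle i q : Sf i q -> v q <= 8 `^ t' * mesh q `^ (t' - t) * mesh q `^ t.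
  move=> Sq; have [/(_ q Sq)[qr _] _ _] := Sfp i; have u0 := @mesh_gt0 R d q.
  (* Since [8 * mesh q <= 1], the exponent may be lowered from [s] to [t']. *)
  apply: (@le_trans _ _ ((8 * mesh q) `^ t')).
    apply: ger_powR => //; rewrite mulr_gt0//=; lra.
  by rewrite powRM ?(ltW u0)// -mulrA -powRD ?subrK// (gt_eqF u0) implybT.
have vsum i (D : set nat) z : 0 <= z -> D `<=` Sf i ->
    (forall q, D q -> mesh q `^ (t' - t) <= z) ->
    (\esum_(q in D) (v q)%:E <= (8 `^ t' * z * h)%:E)%E.
  move=> z0 DS Dz; have [_ Sh _] := Sfp i.
  apply: (@le_trans _ _ (\esum_(q in D) ((8 `^ t' * z)%:E * (mesh q `^ t)%:E))%E).
    apply: le_esum => q Dq; rewrite -EFinM lee_fin.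
    apply: le_trans (vle i q (DS q Dq)) _.
    by rewrite ler_wpM2r ?powR_ge0// ler_wpM2l ?powR_ge0//; exact: Dz.
  apply: le_trans (esumZl_le _ _ _) _; first by rewrite mulr_ge0// ltW.
    by move=> q; rewrite lee_fin powR_ge0.
  rewrite [leRHS]EFinM lee_wpmul2l//; first by rewrite lee_fin mulr_ge0// ltW.
  exact: le_trans (esum_subset _ DS) Sh.
pose W := \bigcup_i Sf (k i).
(* The first cover costs at most [b / 2] by [hb], all tails together at most [b / 4]. *)
have sumW : (\esum_(q in W) (v q)%:E <= (b / 2 + b / 4)%:E)%E.
  apply: le_trans (esum_subset _ (_ : W `<=` Sf (k 0%N) `|` \bigcup_j T j)) _.
    by move=> q [i _ /Tsub].
  apply: le_trans (esum_setU_le _ _ v0) _; rewrite EFinD; apply: leeD.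
    apply: le_trans (_ : ((8 `^ t' * r `^ (t' - t) * h)%:E <= _)%E); last by rewrite lee_fin.
    apply: (vsum (k 0%N)) => //; first exact: powR_ge0.
    move=> q Sq; have [/(_ q Sq)[qr _] _ _] := Sfp (k 0%N).
    by apply: ge0_ler_powR; rewrite ?nnegrE//; apply/ltW => //; exact: mesh_gt0.
  apply: le_trans (esum_bigcup_le _ v0) _.
  have b4 : 0 <= b / 4 by lra.
  apply: le_trans (epsilon_trick0 xpredT b4); apply: lee_nneseries => i _.
    by move=> _; exact: esum_ge0.
  apply: le_trans (vsum (k i.+1) _ (c i) _ _ _) _ => //; first exact: ltW.
  - by move=> q [].
  - by move=> q [_ gq]; apply: gP; exact: ltnW.
  rewrite lee_fin /c; set z := b / 4 / _.
  have z0 : 0 <= z by rewrite /z divr_ge0.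
  have -> : 8 `^ t' * (z / (8 `^ t' * (h + 1))) * h = z * (h / (h + 1)).
    by field; rewrite !gt_eqF//; lra.
  by rewrite ler_piMr// ler_pdivrMr; lra.
pose E := U `&` \bigcup_(q in W) gball2 q.
have mW := bigcup_gball2_borel (R := R) (d := d) W.
have mE : measurable (E : set (borelRV R d)) by exact: measurableI.
have UW0 : m (U `\` \bigcup_(q in W) gball2 q) = 0.
  apply/eqP; rewrite eq_le m_ge0 andbT; apply/ler_addgt0Pr => e e0; rewrite add0r.
  have [a /(_ _ (leqnn a))] := half_powR_small (ltr01 : 0 < 1 :> R) e0.
  rewrite powRr1 ?exprn_ge0 ?invr_ge0// => ae.
  have [_ _ /ltW h1] := Sfp (k a); have [ak _ _] := kP a.
  apply: (@le_trans _ _ (m (U `\` \bigcup_(q in Sf (k a)) gball2 q))).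
    apply: le_m.
    - exact: measurableD.
    - by apply: measurableD => //; exact: bigcup_gball2_borel.
    by apply: setDS => y [q Sq qy]; exists q => //; exists a.
  apply: le_trans h1 (le_trans _ ae).
  by rewrite ler_wiXn2l// ?invr_ge0// invf_le1// ler1n.
have muE : mu E = mu U.
  have /= := measureDI mu mU mW; rewrite -/E (fine_mu mu (measurableD mU mW)) UW0.
  by rewrite add0e.
(* [E] has the full measure of [U], so the essential content of [U], which is at least [b], would be
   at most three quarters of [b]. *)
have : (b%:E <= (b / 2 + b / 4)%:E)%E.
  rewrite -(fine_mu mu (closed_ball_borel _ _)); apply: le_trans bcont _.
  apply: le_trans sumW; apply: (@le_trans _ _ (hausdorff_content (fun x => x `^ s) +oo%E E)).
    by apply: ereal_inf_lbound; exists E => //; split => //; exact: subIsetl.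
  apply: ereal_inf_lbound; exists (W, gball2) => /=; last first.
    by apply: eq_esum => q _; rewrite diam_gball2.
  split; last by move=> y [].
  move=> q _; split; last by rewrite leey.
  by exists (center q), (4 * mesh q); rewrite mulr_gt0// mesh_gt0.
rewrite lee_fin; lra.
Qed.

End content_deficit.

(** * Construction of one level *)

Section levels.
Context {R : realType} {d : nat} (d_gt0 : (0 < d)%N) (mu : probability (borelRV R d) R).
Local Notation gen := (@gen d).
Local Notation mesh := (@mesh R d).
Local Notation gball := (@gball R d).
Local Notation gball2 := (@gball2 R d).
Local Notation m A := (fine (mu A)).
Local Notation K := ((@multiplicity d)%:R : R).
Context (B U : nat -> set 'rV[R]_d) (x : nat -> 'rV[R]_d) (r : nat -> R).
Context (r_gt0 : forall n, 0 < r n).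
Context (BE : forall n, B n = closed_ball (x n) (r n)).
Context (r_small : forall e : R, 0 < e -> exists g, forall n, (g <= n)%N -> r n <= e).
Context (U_open : forall n, open (U n)).
Context (U_sub_B : forall n, U n `<=` B n).

Lemma covering_above (t : R) : (t%:E < critical_exponent mu B U)%E ->
  exists2 N, asymptotically_covering mu B N & forall n, N n ->
    exists2 s, t < s & (mu (B n) <= ess_hausdorff_content mu s (U n))%E.
Proof.
move=> /ereal_sup_gt[_ [s [s0 acs] <-]]; rewrite lte_fin => ts.
exists (critical_indices mu B U s) => // n sn.
have /ereal_sup_gt[_ [s' [s'0 h] <-]] : (t%:E < critical_exponent_ball mu (B n) (U n))%E.
  by apply: lt_le_trans sn; rewrite lte_fin.
by rewrite lte_fin => ts'; exists s'.
Qed.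

(** Dropping the balls of measure zero does not change the covered measure; [cover_deficit] requires
    positive measure. *)
Lemma covering_exhausts_pos (N : set nat) (V : set 'rV[R]_d) (g : nat) (e : R) :
  asymptotically_covering mu B N -> open V -> 0 < e ->
  exists F : set nat, [/\ finite_set F, F `<=` N `&` [set n | 0 < m (B n)],
    forall n, F n -> (g <= n)%N /\ B n `<=` V, trivIset F B &
    m (V `\` \bigcup_(n in F) B n) <= e].
Proof.
move=> acN oV e0; have [F [finF FN FP tF Fe]] := covering_exhausts BE g acN oV e0.
pose pos := [set n | 0 < m (B n)].
exists (F `&` pos); split => //.
- exact: finite_setIl.
- by move=> n [/FN].
- by move=> n [/FP].
- by apply: sub_trivIset tF; exact: subIsetl.
have mB n := ball_borel BE n.
have mU (D : set nat) : measurable (\bigcup_(n in D) B n : set (borelRV R d)).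
  by apply: bigcup_measurable => n _; exact: mB.
have mV := open_borel oV.
apply: le_trans Fe; rewrite -lee_fin -!fine_mu; try exact: measurableD.
apply: (@le_trans _ _ (mu (V `\` \bigcup_(n in F) B n) +
    mu (\bigcup_(n in F `\` pos) B n))%E); last first.
  rewrite -[leRHS]adde0 leeD2l//; apply: le_trans (mu_bigcup_le _ _ mB) _.
  rewrite esum1// => n [_ /negP npos]; congr EFin; apply/eqP.
  by rewrite eq_le m_ge0 andbT leNgt.
apply: le_trans (mu_setU_le _ _ _) => //; last exact: measurableD.
apply: le_measure; rewrite ?inE; try exact: measurableD.
  by apply: measurableU => //; exact: measurableD.
move=> y [Vy ny]; have [[n Fn Bny]|] := pselect ((\bigcup_(n in F) B n) y); last by left.
by right; exists n => //; split => // posn; apply: ny; exists n.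
Qed.

Lemma finite_common_pos (T : set nat) (P : nat -> R -> Prop) (e0 : R) :
  0 < e0 -> finite_set T ->
  (forall n, T n -> exists2 e, 0 < e & forall e', 0 < e' -> e' <= e -> P n e') ->
  exists e, [/\ 0 < e, e <= e0 & forall n, T n -> P n e].
Proof.
move=> e00 /finite_fsetP[X ->] XP.
have : \forall e \near 0^'+, (\bigcap_(n in [set` X]) [set e | P n e]) e.
  apply: filter_bigI => n Xn; have [e e_gt0 eP] := XP n Xn; near=> e'.
  by apply: eP; [near: e'; exact: nbhs_right_gt|near: e'; exact: nbhs_right_le].
move=> Pnear; near (0 : R)^'+ => e; exists e; split.
- by near: e; exact: nbhs_right_gt.
- by near: e; exact: nbhs_right_le.
- by move=> n Xn; apply: (near Pnear e).
Unshelve. all: by end_near. Qed.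

(* The balls of the next level are so small that [cover_deficit] applies to them with a budget
   [4 K / e] times their measure, as [select_ball] requires. *)
Definition level_step (t : R) (V : set (set 'rV[R]_d)) (e : R) (a' : nat) (e' : R) (T : set nat) :=
  [/\ frostman mu t (e / 8) a', 0 < e' <= e / 2, finite_set T,
    forall n, T n -> r n <= 2^-1 ^+ a' /\
      forall S : set nat, (forall q, S q -> mesh q <= r n) ->
        (\esum_(q in S) (mesh q `^ t)%:E <= (4 * K / e * m (B n))%:E)%E ->
        2 * e' <= m (U n `\` \bigcup_(q in S) gball2 q) &
    forall W, V W -> exists F, [/\ finite_set F, F `<=` T,
      forall n, F n -> (a' <= n)%N /\ B n `<=` W, trivIset F B &
      m (W `\` \bigcup_(n in F) B n) <= e / 2]].

Lemma level_step_exists (t t' : R) (V : set (set 'rV[R]_d)) (a : nat) (e : R) :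
  0 < t -> t < t' -> (t%:E < lower_hausdorff_dim mu)%E ->
  (t'%:E < critical_exponent mu B U)%E ->
  finite_set V -> (forall W, V W -> open W) -> 0 < e ->
  exists a' e' T, (a < a')%N /\ level_step t V e a' e' T.
Proof.
move=> t0 tt' tdim t'crit finV oV e0.
have K0 : 0 < K by rewrite ltr0n multiplicity_gt0.
have e8 : 0 < e / 8 by rewrite divr_gt0.
have [a1 fr] := frostman_exists t0 e8 tdim.
pose a' := maxn a1 a.+1.
have t'0 : 0 < t' by exact: lt_trans tt'.
have gam0 : 0 < t' - t by rewrite subr_gt0.
have p8 : 0 < 8 `^ t' :> R by exact: powR_gt0.
(* With the budget [4 * K / e * m (B n)], bounding the power of the radius by this constant gives
   exactly the [m (B n) / 2] that [cover_deficit] allows. *)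
have c0 : 0 < e / (8 * K * 8 `^ t') by rewrite divr_gt0// !mulr_gt0.
have [a2 ha2] := half_powR_small gam0 c0.
(* The 3 ensures [8 * r n <= 1]. *)
pose b := maxn (maxn a' a2) 3.
have u0 n : 0 < 2^-1 ^+ n :> R by rewrite exprn_gt0// invr_gt0.
have [g gP] := r_small (u0 b).
have le_half i j : (i <= j)%N -> 2^-1 ^+ j <= 2^-1 ^+ i :> R.
  by move=> ij; rewrite ler_wiXn2l// ?invr_ge0// invf_le1// ler1n.
have [N acN NP] := covering_above t'crit.
have e2 : 0 < e / 2 by rewrite divr_gt0.
have /choice[F FP] : forall W, exists F : set nat, V W ->
    [/\ finite_set F, F `<=` N `&` [set n | 0 < m (B n)],
      forall n, F n -> (maxn g a' <= n)%N /\ B n `<=` W, trivIset F B &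
      m (W `\` \bigcup_(n in F) B n) <= e / 2].
  move=> W; have [VW|] := pselect (V W); last by exists set0.
  by have [F ?] := covering_exhausts_pos (maxn g a') acN (oV W VW) e2; exists F.
pose T := \bigcup_(W in V) F W.
have finT : finite_set T by apply: bigcup_finite => // W /FP[].
have rT n : T n -> r n <= 2^-1 ^+ b.
  by move=> [W VW Fn]; apply: gP; have [_ _ /(_ n Fn)[]] := FP W VW; rewrite geq_max => /andP[].
pose P n (e' : R) := forall S : set nat, (forall q, S q -> mesh q <= r n) ->
    (\esum_(q in S) (mesh q `^ t)%:E <= (4 * K / e * m (B n))%:E)%E ->
    2 * e' <= m (U n `\` \bigcup_(q in S) gball2 q).
have TP n : T n -> exists2 e1 : R, 0 < e1 & forall e', 0 < e' -> e' <= e1 -> P n e'.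
  move=> Tn; have rn := rT n Tn.
  have [W VW Fn] := Tn; have [_ /(_ n Fn)[Nn /= mBn] _ _ _] := FP W VW.
  have [s t's ess] := NP n Nn.
  have [e1 e10 e1P] : exists2 e1 : R, 0 < e1 & forall S : set nat,
      (forall q, S q -> mesh q <= r n) ->
      (\esum_(q in S) (mesh q `^ t)%:E <= (4 * K / e * m (B n))%:E)%E ->
      e1 <= m (U n `\` \bigcup_(q in S) gball2 q).
    move: mBn ess; rewrite BE => mBn ess.
    apply: (cover_deficit d_gt0 (r_gt0 n) (@U_open n) _ mBn ess tt' (ltW t's) t'0 (r_gt0 n)).
    - by rewrite -BE.
    - have := le_trans rn (le_half 3 b _); rewrite leq_max leqnn orbT => /(_ isT).
      by rewrite !exprS expr0 mulr1; lra.
    - by rewrite mulr_ge0 ?ltW// divr_gt0// mulr_gt0.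
    have rg : r n `^ (t' - t) <= e / (8 * K * 8 `^ t').
      apply: le_trans (ha2 b _); last by rewrite !leq_max leqnn orbT.
      by apply: ge0_ler_powR; rewrite ?nnegrE//; apply: ltW.
    set z := m _ in mBn *.
    apply: (@le_trans _ _ (8 `^ t' * (e / (8 * K * 8 `^ t')) * (4 * K / e * z))).
      by rewrite ler_wpM2r// ?ler_wpM2l// ?ltW// mulr_gt0// divr_gt0// mulr_gt0.
    by rewrite le_eqVlt; apply/orP; left; apply/eqP; field; rewrite !gt_eqF.
  exists (e1 / 2); first by rewrite divr_gt0.
  move=> e'' e''0 e''e S Sr Sh; apply: le_trans (e1P S Sr Sh); lra.
have [e' [e'0 e'e e'P]] := finite_common_pos e2 finT TP.
exists a', e', T; split; first by rewrite leq_max ltnSn orbT.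
split => //.
- by apply: fr; rewrite leq_max leqnn.
- by rewrite e'0.
- move=> n Tn; split; last exact: e'P.
  by apply: le_trans (rT n Tn) (le_half a' b _); rewrite /b -maxnA leq_maxl.
move=> W VW; have [finF _ FW tF mF] := FP W VW; exists (F W); split => //.
  by move=> n Fn; exists W.
by move=> n /FW[]; rewrite geq_max => /andP[].
Qed.

End levels.

(** * Assigning a level to each generation *)

Section level_index.
Context (a : nat -> nat) (a_incr : forall j, (a j < a j.+1)%N).

(** The largest [j] with [a j <= g]; as [j <= a j], the bound on [j] loses nothing. The empty
    maximum gives 0 when [g < a 0]. *)
Definition level_index (g : nat) : nat := \max_(j < g.+1 | (a j <= g)%N) j.

Lemma leq_level j : (j <= a j)%N.
Proof. by elim: j => // j IH; exact: leq_ltn_trans (a_incr j). Qed.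

Lemma level_index_ge j g : (a j <= g)%N -> (j <= level_index g)%N.
Proof.
move=> ajg; have jg : (j < g.+1)%N by rewrite ltnS (leq_trans (leq_level j)).
exact: (@leq_bigmax_cond _ (fun i : 'I_g.+1 => (a i <= g)%N) val (Ordinal jg)).
Qed.

Lemma level_index_le g : (a 0 <= g)%N -> (a (level_index g) <= g)%N.
Proof.
move=> a0g.
have [|i ig iE] := @eq_bigmax_cond _ [pred i : 'I_g.+1 | (a i <= g)%N] val.
  by apply/card_gt0P; exists ord0.
by rewrite /level_index iE.
Qed.

Lemma level_index_mono g g' : (g <= g')%N -> (level_index g <= level_index g')%N.
Proof.
move=> gg'; have [a0g|ga0] := leqP (a 0) g.
  by apply: level_index_ge; exact: leq_trans (level_index_le a0g) gg'.
rewrite /level_index big1 // => i aig; exfalso.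
have : (a 0 <= a i)%N.
  by elim: (nat_of_ord i) => // n IH; exact: leq_trans IH (ltnW (a_incr n)).
by rewrite leqNgt (leq_ltn_trans aig ga0).
Qed.

End level_index.

(** * No cheap family of grid balls covers the limsup set *)

Section contradiction.
Context {R : realType} {d : nat} (d_gt0 : (0 < d)%N) (mu : probability (borelRV R d) R).
Local Notation gen := (@gen d).
Local Notation mesh := (@mesh R d).
Local Notation gball := (@gball R d).
Local Notation gball2 := (@gball2 R d).
Local Notation m A := (fine (mu A)).
Local Notation K := ((@multiplicity d)%:R : R).
Context (B U : nat -> set 'rV[R]_d) (x : nat -> 'rV[R]_d) (r : nat -> R).
Context (r_gt0 : forall n, 0 < r n).
Context (BE : forall n, B n = closed_ball (x n) (r n)).
Context (r_small : forall e : R, 0 < e -> exists g, forall n, (g <= n)%N -> r n <= e).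
Context (U_open : forall n, open (U n)).
Context (U_sub_B : forall n, U n `<=` B n).
Context (t : nat -> R) (t_gt0 : 0 < t 0) (t_incr : forall j, t j < t j.+1).
Context (t_dim : forall j, ((t j)%:E < lower_hausdorff_dim mu)%E).
Context (t_crit : forall j, ((t j)%:E < critical_exponent mu B U)%E).

Lemma exponent_gt0 j : 0 < t j.
Proof. by elim: j => // j IH; exact: lt_trans (t_incr j). Qed.

(** The open sets inside which the balls of level [j] are chosen. *)
Definition domains (T : nat -> set nat) (j : nat) : set (set 'rV[R]_d) :=
  if j is i.+1 then U @` T i else [set setT].

Lemma levels_exist : exists (a : nat -> nat) (e : nat -> R) (T : nat -> set nat),
  [/\ forall j, (a j < a j.+1)%N, e 0%N = 1 / 2 &
    forall j, 0 < e j /\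
      level_step mu B U r (t j) (domains T j) (e j) (a j) (e j.+1) (T j)].
Proof.
pose state := (nat * R * set (set 'rV[R]_d))%type.
pose inv (s : state) := [/\ 0 < s.1.2, finite_set s.2 & forall W, s.2 W -> open W].
(* Assuming the invariant under the existential makes the step total, so that [choice] applies. *)
have step (p : nat * state) : exists sT : state * set nat, inv p.2 ->
    [/\ inv sT.1, (p.2.1.1 < sT.1.1.1)%N, sT.1.2 = U @` sT.2 &
      level_step mu B U r (t p.1) p.2.2 p.2.1.2 sT.1.1.1 sT.1.1.2 sT.2].
  case: p => j [[a e] V] /=; have [[/= e0 finV oV]|ninv] := pselect (inv (a, e, V)).
    have [a' [e' [T [aa' ls]]]] := level_step_exists d_gt0 r_gt0 BE r_small U_open U_sub_B
      a (exponent_gt0 j) (t_incr j) (t_dim j) (t_crit j.+1) finV oV e0.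
    exists ((a', e', U @` T), T) => _; split => //; have [_ /andP[e'0 _] finT _ _] := ls.
      by split => //=; [exact: finite_image|move=> _ [n _ <-]; exact: U_open].
  by exists ((0%N, 0, set0), set0).
have [f fP] := choice step.
pose s := fix s j : state := if j is i.+1 then (f (i, s i)).1 else (0%N, 1 / 2, [set setT]).
have sinv j : inv (s j).
  elim: j => [|j IH] /=; last by have [] := fP (j, s j) IH.
  by split => //= _ ->; exact: openT.
have sP j := fP (j, s j) (sinv j).
(* The shift in the first component: the generation bound of level [j] is an output of step [j],
   whereas its [e j] is an input. *)
exists (fun j => (s j.+1).1.1), (fun j => (s j).1.2), (fun j => (f (j, s j)).2).
split => // [j|j]; first by have [] := sP j.+1.
split; first by have [] := sinv j.
have -> : domains (fun j => (f (j, s j)).2) j = (s j).2.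
  by case: j => //= j; have [] := sP j.
by have [] := sP j.
Qed.

Section fixed_levels.
Context (a : nat -> nat) (e : nat -> R) (T : nat -> set nat).
Context (a_incr : forall j, (a j < a j.+1)%N) (e0E : e 0%N = 1 / 2).
Context (e_gt0 : forall j, 0 < e j).
Context (steps : forall j,
  level_step mu B U r (t j) (domains T j) (e j) (a j) (e j.+1) (T j)).
Local Notation J := (level_index a).

(** The gauge at the scale of the grid ball: the exponent is that of the level to which its
    generation belongs. *)
Definition weight q : R := mesh q `^ t (J (gen q)).

Context (S : set nat).
Context (S_gen : forall q, S q -> (a 0 <= gen q)%N).
Context (S_sum : (\esum_(q in S) (weight q)%:E <= 1)%E).

Lemma weight_ge0 q : 0 <= weight q. Proof. exact: powR_ge0. Qed.

Lemma e_halves j i : e (j + i)%N <= e j / 2 ^+ i.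
Proof.
elim: i => [|i IH]; first by rewrite addn0 expr0 divr1.
have [_ /andP[_ h] _ _ _] := steps (j + i); rewrite addnS (le_trans h)//.
by rewrite exprS invfM mulrA mulrAC ler_wpM2r ?invr_ge0.
Qed.

(** By [frostman_bigcup] the grid balls of level [j + i] have measure at most [e (j + i) / 4], hence
    at most the share 2^-(i+1) of [e j / 2]. *)
Lemma tail_le j (S' : set nat) : S' `<=` S -> (forall q, S' q -> (j <= J (gen q))%N) ->
  m (\bigcup_(q in S') gball2 q) <= e j / 2.
Proof.
move=> S'S S'j; pose Si i := S' `&` [set q | J (gen q) = (j + i)%N].
rewrite -lee_fin -fine_mu; last exact: bigcup_gball2_borel.
have -> : \bigcup_(q in S') gball2 q = \bigcup_i \bigcup_(q in Si i) gball2 q.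
  apply/seteqP; split => [y [q S'q qy]|y [i _ [q [S'q _] qy]]]; last by exists q.
  by exists (J (gen q) - j)%N => //; exists q => //; split => //=; rewrite subnKC// S'j.
apply: le_trans (mu_bigcup_le _ _ _) _; first by move=> i; exact: bigcup_gball2_borel.
rewrite -nneseries_esumT; last by move=> i; rewrite lee_fin m_ge0.
have ej2 : 0 <= e j / 2 by rewrite divr_ge0// ltW.
apply: le_trans (epsilon_trick0 xpredT ej2); apply: lee_nneseries => i _.
  by move=> _; rewrite lee_fin m_ge0.
rewrite lee_fin; have [fr _ _ _ _] := steps (j + i).
apply: (@le_trans _ _ (2 * (e (j + i)%N / 8))).
  apply: (frostman_bigcup _ fr).
  - by rewrite divr_ge0// ltW.
  - by move=> q [S'q /= <-]; apply: level_index_le; exact/S_gen/S'S.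
  apply: le_trans _ S_sum; apply: le_trans (esum_subset _ (subset_trans (@subIsetl _ _ _) S'S)).
  by apply: le_esum => q [_ /= Jq]; rewrite /weight Jq.
have := e_halves j i; rewrite expnS natrM natrX invfM; set z := (2 ^+ i)^-1; lra.
Qed.

(* Grid balls weighted with the exponent [t j] leave the deficit of [level_step]; those of later
   levels have small total measure. *)
Lemma survive j n : T j n -> (forall q, meeting S (U n) q -> mesh q <= r n) ->
  (\esum_(q in meeting S (U n)) (weight q)%:E <= (4 * K / e j * m (B n))%:E)%E ->
  e j.+1 <= m (U n `\` \bigcup_(q in meeting S (U n)) gball2 q).
Proof.
move=> Tn small cheap; have [_ _ _ /(_ n Tn)[rn deficit] _] := steps j.
set M := meeting S (U n) in small cheap *.
have MS : M `<=` S by exact: subIsetl.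
(* A mesh of at most [r n], which is at most 2^-(a j), forces the generation to be at least
   [a j]. *)
have Mj q : M q -> (j <= J (gen q))%N.
  move=> Mq; apply: level_index_ge => //; rewrite leqNgt; apply/negP => qa.
  have := le_trans (small q Mq) rn; rewrite leNgt => /negP; apply.
  by rewrite /mesh ltr_iXn2l// ?invr_gt0// invf_lt1// ltr1n.
pose M1 := M `&` [set q | J (gen q) = j]; pose M2 := M `&` [set q | (j < J (gen q))%N].
have h1 : 2 * e j.+1 <= m (U n `\` \bigcup_(q in M1) gball2 q).
  apply: deficit => [q [/small]//|].
  apply: le_trans cheap; apply: le_trans (esum_subset _ (@subIsetl _ M _)).
  by apply: le_esum => q [_ /= Jq]; rewrite /weight Jq.
have h2 : m (\bigcup_(q in M2) gball2 q) <= e j.+1 / 2.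
  by apply: tail_le => [q [/MS]|q []].
have mU := open_borel (@U_open n).
have mM D := bigcup_gball2_borel (R := R) (d := d) D.
have : m (U n `\` \bigcup_(q in M1) gball2 q) <=
    m (U n `\` \bigcup_(q in M) gball2 q) + m (\bigcup_(q in M2) gball2 q).
  rewrite -lee_fin EFinD -!fine_mu//; try exact: measurableD.
  apply: le_trans (mu_setU_le _ _ _) => //; last exact: measurableD.
  apply: le_measure; rewrite ?inE; try exact: measurableD.
    by apply: measurableU => //; exact: measurableD.
  move=> y [Uy nM1]; have [[q Mq qy]|] := pselect ((\bigcup_(q in M) gball2 q) y); last by left.
  right; exists q => //; split => //=; rewrite ltn_neqAle Mj// andbT.
  by apply/eqP => jq; apply: nM1; exists q.
have := e_gt0 j.+1; lra.
Qed.

Lemma limsup_not_covered : ~ (lim_sup_set U `<=` \bigcup_(q in S) gball q).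
Proof.
move=> cov.
pose P j n := [/\ T j n, forall q, meeting S (U n) q -> mesh q <= r n &
  (\esum_(q in meeting S (U n)) (weight q)%:E <= (4 * K / e j * m (B n))%:E)%E].
have child j V : domains T j V -> open V ->
    e j <= m (V `\` \bigcup_(q in meeting S V) gball2 q) ->
    exists n, [/\ P j n, B n `<=` V & (a j <= n)%N].
  move=> TV oV eV; have [_ _ _ _ /(_ V TV)[F [finF FT FV tF Fe]]] := steps j.
  have FV' n : F n -> B n `<=` V by move=> /FV[].
  have [n Fn [small cheap]] :=
    select_ball r_gt0 BE U_sub_B oV weight_ge0 S_sum (e_gt0 j) finF tF FV' Fe eV.
  by exists n; have [? ?] := FV n Fn; split => //; split => //; exact: FT.
(* At the start, all grid balls of [S] together have measure at most [e 0 / 2 = 1 / 4], which leaves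
   more than [e 0]. *)
have [n0 [Pn0 _ _]] : exists n, [/\ P 0%N n, B n `<=` setT & (a 0 <= n)%N].
  apply: child => //; first exact: openT.
  have -> : meeting S (setT : set 'rV[R]_d) = S.
    apply/seteqP; split => [q []//|q Sq]; split => //; exists (center q); split => //.
    by apply/gballP; rewrite subrr normr0 mulr_ge0// ltW// mesh_gt0.
  have mM := bigcup_gball2_borel (R := R) (d := d) S.
  have h : m (\bigcup_(q in S) gball2 q) <= e 0%N / 2 by exact: tail_le.
  rewrite m_setD// probability_setT /=; move: h; rewrite e0E; lra.
have /choice[f fP] : forall jn : nat * nat, exists n', P jn.1 jn.2 ->
    [/\ P jn.1.+1 n', B n' `<=` U jn.2 & (a jn.1.+1 <= n')%N].
  move=> [j n] /=; have [[Tn small cheap]|] := pselect (P j n); last by exists 0%N.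
  have [n' ?] := child j.+1 (U n) (ex_intro2 _ _ n Tn erefl) (@U_open n) (survive Tn small cheap).
  by exists n'.
pose c := fix c j := if j is i.+1 then f (i, c i) else n0.
have cP j : P j (c j) by elim: j => //= j IH; have [] := fP (j, c j) IH.
have cU j : B (c j.+1) `<=` U (c j) by have [] := fP (j, c j) (cP j).
have ca j : (j < c j.+1)%N.
  by have [_ _] := fP (j, c j) (cP j); move=> h; exact: leq_trans (leq_level a_incr j.+1) h.
have cB i j : (i <= j)%N -> B (c j) `<=` B (c i).
  move=> /subnK <-; elim: (j - i)%N => // k IH; apply: subset_trans IH.
  by rewrite addSn; apply: subset_trans (cU _) (@U_sub_B _).
have clB j : closed (B (c j)) by rewrite BE; exact: closed_ball_closed.
have cptB : compact (B (c 0%N)).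
  apply: bounded_closed_compact => //; exists (`|x (c 0%N)| + r (c 0%N)).
  split; first exact: num_real.
  move=> M xM y; rewrite BE => /(closed_ballP _ _ (r_gt0 _)) xy; apply: le_trans (ltW xM).
  rewrite -[y](subKr (x (c 0%N))); apply: le_trans (ler_normB _ _) _.
  by rewrite lerD2l.
have xB j : B (c j) (x (c j)).
  by rewrite BE; apply/closed_ballP => //; rewrite subrr normr0 ltW.
(* A cluster point of the centres lies in all the nested closed balls. *)
have [y [_ ycl]] := cptB (fun A => \forall j \near \oo, A (x (c j))) _
  (nearW _ (fun j => cB 0%N j (leq0n j) _ (xB j))).
have yB j : B (c j) y.
  rewrite (closure_id (B (c j))).1// => A yA; apply: ycl => //.
  by exists j => // k /= jk; apply: cB jk _ _; exact: xB.
have yU j : U (c j) y by exact: cU (yB j.+1).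
have : lim_sup_set U y.
  by move=> n _; exists (c n.+1); [exact: ltnW (ca n)|exact: yU].
(* The grid ball [q] meets every [U (c j)] at [y], so its mesh is at most every [r (c j)], although
   these radii tend to 0. *)
move=> /cov[q Sq qy].
have rq j : mesh q <= r (c j).
  by have [_ small _] := cP j; apply: small; split => //; exists y.
have [g gP] := r_small (divr_gt0 (@mesh_gt0 R d q) (ltr0Sn _ 1)).
have := gP (c g.+1) (ltnW (ca g)); have := rq g.+1; have := @mesh_gt0 R d q; lra.
Qed.

End fixed_levels.
End contradiction.

(** * One-sided limits at 0 and approximating exponents *)

Lemma at_right0_exists (R : realType) (P : R -> Prop) : (\forall x \near 0^'+, P x) ->
  exists2 e : R, 0 < e & forall x, 0 < x -> x < e -> P x.
Proof.
move=> /nbhs_ballP[e /= e0 eP]; exists e => // x x0 xe.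
by apply: eP => //; rewrite -ball_normE /= sub0r normrN gtr0_norm.
Qed.

Lemma exponents_exist (R : realType) (s : \bar R) : (0 < s)%E ->
  exists t : nat -> R, [/\ 0 < t 0%N, forall j, t j < t j.+1, forall j, ((t j)%:E < s)%E &
    forall c : R, (c%:E < s)%E -> exists j, c < t j].
Proof.
case: s => [s|_|//].
  (* Denominators start at 2 to keep [t 0] positive. *)
  rewrite lte_fin => s0; exists (fun j => s - s / j.+2%:R).
  have s2 j : 0 < s / j.+2%:R by rewrite divr_gt0.
  split.
  - by lra.
  - move=> j; rewrite ltrD2l ltrN2 ltr_pM2l// ltf_pV2 ?posrE// ltr_nat//.
  - by move=> j; rewrite lte_fin gtrBl.
  move=> c; rewrite lte_fin => cs; exists (Num.truncn (s / (s - c))).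
  rewrite ltrBrDr -ltrBrDl ltr_pdivrMr// mulrC -ltr_pdivrMr ?subr_gt0//.
  by apply: lt_trans (real_truncnS_gt (num_real _)) _; rewrite ltr_nat.
exists (fun j => j.+1%:R); split => //.
- by move=> j; rewrite ltr_nat.
- by move=> j; rewrite ltry.
move=> c _; exists (Num.truncn c); exact: real_truncnS_gt (num_real _).
Qed.

Lemma cvge_from_below (R : realType) (f : R -> R) (s : \bar R) : (0 < s)%E ->
  (\forall x \near 0^'+, ((f x)%:E <= s)%E) ->
  (forall c : R, (c%:E < s)%E -> \forall x \near 0^'+, c <= f x) ->
  (f x)%:E @[x --> 0^'+] --> s.
Proof.
case: s => [s|_|//].
  move=> _ fs sf; apply: cvg_EFin; first exact: nearW.
  apply/cvgrPdist_le => e e0 /=.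
  have se : ((s - e)%:E < s%:E)%E by rewrite lte_fin gtrBl.
  near=> x; rewrite ler_norml; apply/andP; split.
    have : ((f x)%:E <= s%:E)%E by near: x.
    by rewrite lee_fin; lra.
  have : s - e <= f x by near: x; exact: sf.
  lra.
move=> _ sf; apply/cvgeyPge => A; near=> x; rewrite lee_fin; near: x.
by apply: sf; rewrite ltry.
Unshelve. all: by end_near. Qed.

(** * The gauge and its order at 0 *)

Section gauge.
Context {R : realType} (t : nat -> R) (a : nat -> nat).
Context (t_pos : forall j, 0 < t j) (t_incr : forall j, t j < t j.+1).
Context (a_incr : forall j, (a j < a j.+1)%N).
Local Notation J := (level_index a).

(** For [0 < x <= 1] this is the [n] with 2^-(n+1) < x <= 2^-n. *)
Definition scale (x : R) : nat := Num.truncn (- ln x / ln 2).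

Definition level_weight (g : nat) : R := (2^-1 ^+ g) `^ t (J g).

(* The factor [1 + x] only serves to make the step function strictly increasing. *)
Definition level_gauge (x : R) : R :=
  if x <= 0 then 0 else (1 + x) * level_weight (scale x).

Let ln2_gt0 : 0 < ln 2 :> R. Proof. by rewrite ln_gt0// ltr1n. Qed.

Lemma half_gt0 n : 0 < 2^-1 ^+ n :> R. Proof. by rewrite exprn_gt0// invr_gt0. Qed.

Lemma half_le i j : (i <= j)%N -> 2^-1 ^+ j <= 2^-1 ^+ i :> R.
Proof. by move=> ij; rewrite ler_wiXn2l// ?invr_ge0// invf_le1// ler1n. Qed.

Lemma ln_half n : ln (2^-1 ^+ n) = - (n%:R * ln 2) :> R.
Proof. by rewrite lnXn ?invr_gt0// lnV ?posrE// mulNrn mulr_natl. Qed.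

Lemma scale_bounds x : 0 < x -> x <= 1 ->
  (scale x)%:R * ln 2 <= - ln x /\ - ln x < (scale x).+1%:R * ln 2.
Proof.
move=> x0 x1; have : 0 <= - ln x / ln 2 by rewrite divr_ge0 ?oppr_ge0 ?ln_le0// ltW.
by move=> /truncn_itv /andP[]; rewrite ler_pdivlMr// ltr_pdivrMr.
Qed.

Lemma le_scale x : 0 < x -> x <= 1 -> x <= 2^-1 ^+ scale x.
Proof.
move=> x0 x1; have [h _] := scale_bounds x0 x1.
rewrite -ler_ln ?posrE ?half_gt0// ln_half; lra.
Qed.

Lemma scale_ge n x : 0 < x -> x <= 1 -> x <= 2^-1 ^+ n -> (n <= scale x)%N.
Proof.
move=> x0 x1 xn; rewrite truncn_ge_nat; last first.
  by rewrite divr_ge0 ?oppr_ge0 ?ln_le0// ltW.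
rewrite ler_pdivlMr//; move: xn.
rewrite -ler_ln ?posrE ?half_gt0// ln_half; lra.
Qed.

Lemma exponent_mono i j : (i <= j)%N -> t i <= t j.
Proof.
by move=> /subnK <-; elim: (j - i)%N => // k /le_trans; apply; rewrite addSn ltW.
Qed.

Lemma level_weight_gt0 g : 0 < level_weight g.
Proof. by rewrite powR_gt0// half_gt0. Qed.

Lemma level_weight_mono g g' : (g <= g')%N -> level_weight g' <= level_weight g.
Proof.
move=> gg'; apply: (@le_trans _ _ ((2^-1 ^+ g') `^ t (J g))).
  apply: ger_powR; first by rewrite half_gt0 (half_le (leq0n g')).
  exact/exponent_mono/level_index_mono.
by apply: ge0_ler_powR; rewrite ?nnegrE ?(ltW (t_pos _)) ?(ltW (half_gt0 _))// half_le.
Qed.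

Lemma level_gaugeE x : 0 < x -> level_gauge x = (1 + x) * level_weight (scale x).
Proof. by move=> x0; rewrite /level_gauge leNgt x0. Qed.

Lemma level_weight_le_gauge x : 0 < x -> level_weight (scale x) <= level_gauge x.
Proof.
move=> x0; rewrite level_gaugeE// -[leLHS]mul1r ler_wpM2r ?(ltW (level_weight_gt0 _))//.
by rewrite lerDl ltW.
Qed.

Lemma gauge_function_level_gauge : gauge_function level_gauge.
Proof.
have pos x : 0 < x -> 0 < level_gauge x.
  by move=> x0; rewrite level_gaugeE// mulr_gt0 ?level_weight_gt0// addr_gt0.
split.
- move=> x; rewrite le_eqVlt => /predU1P[<-|/pos/ltW//].
  by rewrite /level_gauge lexx.
- exists 1 => // x y; rewrite le_eqVlt => /predU1P[<-|x0] xy y1.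
    by rewrite {1}/level_gauge lexx pos.
  have y0 : 0 < y by exact: lt_trans xy.
  rewrite !level_gaugeE//; apply: (@lt_le_trans _ _ ((1 + y) * level_weight (scale x))).
    by rewrite ltr_pM2r ?level_weight_gt0// ltrD2l.
  rewrite ler_wpM2l//; first by rewrite addr_ge0// ltW.
  apply: level_weight_mono; apply: le_truncn.
  by rewrite ler_pM2r ?invr_gt0// lerN2 ler_ln ?posrE// ltW.
- by rewrite /level_gauge lexx.
Qed.

(** The quotient is the current exponent times a factor within [ln 2 / - ln x] of 1, minus a term
    that tends to 0. Both errors lower the quotient, so it stays below [s]. *)
Lemma level_gauge_cvg (s : \bar R) : (0 < s)%E -> (forall j, ((t j)%:E < s)%E) ->
  (forall c : R, (c%:E < s)%E -> exists j, c < t j) ->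
  (ln (level_gauge x) / ln x)%:E @[x --> (0 : R)^'+] --> s.
Proof.
move=> s0 ts st.
have ratio x : 0 < x -> x < 1 -> ln (level_gauge x) / ln x =
    t (J (scale x)) * ((scale x)%:R * ln 2 / - ln x) - ln (1 + x) / - ln x.
  move=> x0 x1; have lx : ln x < 0 by rewrite ln_lt0// x0.
  rewrite level_gaugeE// lnM ?posrE ?level_weight_gt0 ?addr_gt0//.
  rewrite /level_weight ln_powR ln_half; field.
  by rewrite lt_eqF.
apply: cvge_from_below => //.
  near=> x; have x0 : 0 < x by near: x; exact: nbhs_right_gt.
  have x1 : x < 1 by near: x; exact: nbhs_right_lt.
  apply: le_trans (ltW (ts (J (scale x)))); rewrite ratio// lee_fin.
  have lx : 0 < - ln x by rewrite oppr_gt0 ln_lt0// x0.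
  have h1 : 0 <= ln (1 + x) / - ln x.
    by rewrite divr_ge0 ?ln_ge0// ?(ltW lx)// lerDl ltW.
  have [h2 _] := scale_bounds x0 (ltW x1).
  have : t (J (scale x)) * ((scale x)%:R * ln 2 / - ln x) <= t (J (scale x)).
    by rewrite ler_piMr ?(ltW (t_pos _))// ler_pdivrMr// mul1r.
  lra.
move=> c cs; have [j cj] := st c cs.
(* The constant [del] solves [t j * (1 - del) - del = c]; each of the two errors will be at most
   [del]. *)
have del0 : 0 < (t j - c) / (t j + 1).
  by rewrite divr_gt0 ?subr_gt0// addr_gt0.
set del := (t j - c) / (t j + 1) in del0.
near=> x; have x0 : 0 < x by near: x; exact: nbhs_right_gt.
have x1 : x < 1 by near: x; exact: nbhs_right_lt.
have xa : x <= 2^-1 ^+ a j by near: x; apply: nbhs_right_le; exact: half_gt0.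
have xd : x <= expR (- (ln 2 / del)) by near: x; apply: nbhs_right_le; exact: expR_gt0.
have lx : 0 < - ln x by rewrite oppr_gt0 ln_lt0// x0.
have jJ : t j <= t (J (scale x)).
  by apply/exponent_mono/level_index_ge => //; exact: scale_ge (ltW x1) xa.
have [_ h2] := scale_bounds x0 (ltW x1).
have dL : ln 2 / - ln x <= del.
  rewrite ler_pdivrMr// mulrC -ler_pdivrMr//.
  by move: xd; rewrite -ler_ln ?posrE ?expR_gt0// expRK; lra.
have h3 : ln (1 + x) / - ln x <= ln 2 / - ln x.
  by rewrite ler_pM2r ?invr_gt0// ler_ln ?posrE ?addr_gt0//; lra.
have h4 : 1 - ln 2 / - ln x <= (scale x)%:R * ln 2 / - ln x.
  rewrite lerBlDr -mulrDl ler_pdivlMr// mul1r.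
  by move: h2; rewrite -natr1 mulrDl mul1r => /ltW.
rewrite ratio//.
have : t j * (1 - del) <= t (J (scale x)) * ((scale x)%:R * ln 2 / - ln x).
  apply: (@le_trans _ _ (t j * ((scale x)%:R * ln 2 / - ln x))).
    by rewrite ler_wpM2l ?(ltW (t_pos _))//; lra.
  by rewrite ler_wpM2r// divr_ge0 ?(ltW lx)// mulr_ge0// ltW.
have : del * (t j + 1) = t j - c.
  by rewrite /del divfK// gt_eqF// addr_gt0.
lra.
Unshelve. all: by end_near. Qed.

End gauge.

(** Smaller scales admit fewer covers, so the contents are monotone in the scale and their limit
    exists. *)
Lemma hausdorff_measure_ge1 (R : realType) (d : nat) (zeta : R -> R) (E : set 'rV[R]_d) (tau0 : R) :
  0 < tau0 ->
  (forall tau, 0 < tau -> tau < tau0 -> (1 <= hausdorff_content zeta tau%:E E)%E) ->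
  (1 <= hausdorff_measure zeta E)%E.
Proof.
move=> tau00 ge1; apply: lime_ge.
  apply: nonincreasing_at_right_is_cvge; apply: nearW => b x y _ _ xy.
  apply: le_ereal_inf => _ [[D L] /= [Lx EL] <-]; exists (D, L) => //=.
  split => // n Dn; have [? Ln] := Lx n Dn; split => //.
  by apply: le_trans Ln _; rewrite lee_fin.
near=> tau; apply: ge1; near: tau; first exact: nbhs_right_gt.
exact: nbhs_right_lt.
Unshelve. all: by end_near. Qed.

(** * From arbitrary covers to grid balls, and the two conclusions *)

Section main.
Context (R : realType) (d : nat) (B U : nat -> set 'rV[R]_d).
Context (d_gt0 : (0 < d)%N).
Context (B_ball : forall n, is_closed_ball (B n)).
Context (diamB : diam (B n) @[n --> \oo] --> (0 : R)).
Context (U_open : forall n, open (U n)).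
Context (U_sub_B : forall n, U n `<=` B n).

(** The bound is stated for contents at small scales, because the dimension estimate compares the
    gauge with a power cover by cover. *)
Lemma limsup_gauge (mu : probability (borelRV R d) R) (s : \bar R) :
  s = Order.min (critical_exponent mu B U) (lower_hausdorff_dim mu) -> (0 < s)%E ->
  exists zeta : R -> R, [/\ gauge_function zeta,
    (ln (zeta r) / ln r)%:E @[r --> (0 : R)^'+] --> s &
    exists2 tau0 : R, 0 < tau0 & forall tau, 0 < tau -> tau < tau0 ->
      (1 <= hausdorff_content zeta tau%:E (lim_sup_set U))%E].
Proof.
move=> sE s0.
have /choice[xr xrP] : forall n, exists xr : 'rV[R]_d * R,
    0 < xr.2 /\ B n = closed_ball xr.1 xr.2.
  by move=> n; have [x [r ?]] := B_ball n; exists (x, r).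
pose x n := (xr n).1; pose r n := (xr n).2.
have r_gt0 n : 0 < r n by have [] := xrP n.
have BE n : B n = closed_ball (x n) (r n) by have [] := xrP n.
have r_small (e : R) : 0 < e -> exists g, forall n, (g <= n)%N -> r n <= e.
  move=> e0; have /cvgrPdist_le /(_ _ e0)[g _ gP] := diamB; exists g => n gn.
  have := gP n gn; rewrite /= sub0r normrN BE diam_closed_ball//.
  by have := r_gt0 n; move=> rn; rewrite ger0_norm; lra.
have [t [t0 t_incr ts st]] := exponents_exist s0.
have t_dim j : ((t j)%:E < lower_hausdorff_dim mu)%E.
  by apply: lt_le_trans (ts j) _; rewrite sE ge_min lexx orbT.
have t_crit j : ((t j)%:E < critical_exponent mu B U)%E.
  by apply: lt_le_trans (ts j) _; rewrite sE ge_min lexx.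
have t_pos := exponent_gt0 t0 t_incr.
have [a [e [T [a_incr e0E steps]]]] :=
  levels_exist d_gt0 r_gt0 BE r_small U_open U_sub_B t0 t_incr t_dim t_crit.
exists (level_gauge t a); split.
- exact: gauge_function_level_gauge.
- exact: level_gauge_cvg.
(* Balls below this diameter are replaced by grid balls of generation at least [a 0], as
   [limsup_not_covered] requires. *)
exists (2^-1 ^+ a 0%N); first exact: half_gt0.
move=> tau tau0 taua; apply: le_ereal_inf_tmp => _ [[D L] /= [LP cov] <-].
rewrite leNgt; apply/negP => small.
have /choice[f fP] : forall n, exists q, D n -> [/\ 0 < diam (L n),
    (a 0 <= scale (diam (L n)))%N, @gen d q = scale (diam (L n)) & L n `<=` @gball R d q].
  move=> n; have [Dn|] := pselect (D n); last by exists 0%N.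
  have [[y [rho [rho0 LE]]]] := LP n Dn; rewrite lee_fin LE diam_closed_ball// => rtau.
  have ra : 2 * rho <= 2^-1 ^+ a 0%N by apply/ltW/(le_lt_trans rtau).
  have r1 : 2 * rho <= 1 by rewrite (le_trans ra)// exprn_ile1// ?invr_ge0// invf_le1// ler1n.
  have r0 : 0 < 2 * rho by rewrite mulr_gt0.
  have rs : rho <= 2^-1 ^+ scale (2 * rho) by apply: le_trans (le_scale r0 r1); lra.
  have [q qn Lq] := closed_ball_sub_gball y rho0 rs.
  by exists q => _; split => //; exact: scale_ge.
pose S := f @` D.
have S_gen q : S q -> (a 0 <= @gen d q)%N by move=> [n Dn <-]; have [_ h -> _] := fP n Dn.
(* Several covering balls may yield the same grid ball, which only lowers the sum over [S]. *)
have S_sum : (\esum_(q in S) (@weight R d t a q)%:E <= 1)%E.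
  apply: le_trans (ltW small); apply: le_trans (esum_image_le _ _ _) _.
    by move=> q; rewrite lee_fin weight_ge0.
  apply: le_esum => n /fP[L0 _ fn _]; rewrite lee_fin /weight /mesh fn.
  exact: level_weight_le_gauge.
apply: (limsup_not_covered r_gt0 BE r_small U_open U_sub_B a_incr e0E
  (fun j => (steps j).1) (fun j => (steps j).2) S_gen S_sum).
by move=> y /cov[n Dn Ly]; exists (f n); [exists n|have [_ _ _] := fP n Dn; exact].
Qed.

End main.

Theorem theorem2p2 (R : realType) (d : nat) (B U : nat -> set 'rV[R]_d)
  (d_gt0 : (0 < d)%N)
  (B_ball : forall n, is_closed_ball (B n))
  (diamB : diam (B n) @[n --> \oo] --> (0 : R))
  (U_open : forall n, open (U n))
  (U_sub_B : forall n, U n `<=` B n) :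
  (forall mu : probability (borelRV R d) R,
    (0 < Order.min (critical_exponent mu B U) (lower_hausdorff_dim mu))%E ->
    exists zeta : R -> R,
      [/\ gauge_function zeta,
          (ln (zeta r) / ln r)%:E @[r --> (0 : R)^'+] -->
            Order.min (critical_exponent mu B U) (lower_hausdorff_dim mu)
        & (0 < hausdorff_measure zeta (lim_sup_set U))%E]) /\
  (forall mu : probability (borelRV R d) R,
    (Order.min (critical_exponent mu B U) (lower_hausdorff_dim mu)
       <= hausdorff_dim (lim_sup_set U))%E).
Proof.
split=> mu.
  move=> s0; have [zeta [gz cz [tau0 tau00 ge1]]] :=
    limsup_gauge d_gt0 B_ball diamB U_open U_sub_B erefl s0.
  exists zeta; split => //.
  by apply: lt_le_trans (hausdorff_measure_ge1 tau00 ge1); rewrite lte_fin.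
(* Otherwise some [b] below [s] would give the limsup set measure zero in dimension [b]; as [b] is
   nonnegative, [s] is positive and [limsup_gauge] applies. *)
set s := Order.min _ _; apply: le_ereal_inf_tmp => _ [b /= [b0 Hb0] <-].
rewrite leNgt; apply/negP => bs.
have s0 : (0 < s)%E by apply: le_lt_trans bs; rewrite lee_fin.
have [zeta [_ cz [tau0 tau00 ge1]]] :=
  limsup_gauge d_gt0 B_ball diamB U_open U_sub_B erefl s0.
have sb : nbhs s [set y | (b%:E < y)%E].
  by apply: open_nbhs_nbhs; split => //; exact: open_ereal_gt_ereal.
have /at_right0_exists[e1 e10 e1P] :
    \forall x \near (0 : R)^'+, (b%:E < (ln (zeta x) / ln x)%:E)%E by exact: cz sb.
(* Near 0 the gauge is at most the power with exponent [b], as [ln x < 0]; so every cover at a small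
   scale also costs at least 1 for that power. *)
suff : (1 <= hausdorff_measure (fun x => (x `^ b)%R) (lim_sup_set U))%E.
  by rewrite Hb0 lee_fin ler10.
have tau10 : 0 < Num.min (Num.min e1 1) tau0 by rewrite !lt_min e10 ltr01.
apply: hausdorff_measure_ge1 tau10 _ => tau tau_gt0.
rewrite !lt_min => /andP[/andP[taue tau1] tautau].
apply: le_trans (ge1 tau tau_gt0 tautau) _.
apply: le_ereal_inf_tmp => _ [[D L] /= DL <-].
apply: (@le_trans _ _ (\esum_(n in D) (zeta (diam (L n)))%:E)%E).
  by apply: ereal_inf_lbound; exists (D, L).
apply: le_esum => n Dn; rewrite lee_fin.
have [[y [rho [rho0 LE]]]] := DL.1 n Dn; rewrite lee_fin LE diam_closed_ball//.
set z := 2 * rho => ztau; have z0 : 0 < z by rewrite mulr_gt0.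
have := e1P z z0 (le_lt_trans ztau taue); rewrite lte_fin.
have lz : ln z < 0 by rewrite ln_lt0// z0 (le_lt_trans ztau).
rewrite ltr_ndivlMr// => h.
have [zz|zz] := leP (zeta z) 0; first exact: le_trans zz (powR_ge0 _ _).
by rewrite -ler_ln ?posrE ?powR_gt0// ln_powR ltW.
Qed.
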